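(* Let $\mu\in\mathbb R$, $v>0$, $0<s<t$ and $\eta>0$. Then $$ \lim_{\delta\to0}\ \lim_{u\downarrow v}\ P\Big\{\max_{s-\delta\le z\le s+\delta}|B^\mu(z)|\le\eta\ \Big|\ \min_{0\le z\le t}B^\mu(z)>v,\ B^\mu(0)=u\Big\}=P\Big\{B^\mu(s)\le\eta\ \Big|\ \inf_{0<z<t}B^\mu(z)>v,\ B^\mu(0)=v\Big\}. $$
   Context: $B$ is a standard one-dimensional Brownian motion and $B^\mu(t)=B(t)+\mu t$ is Brownian motion with drift $\mu$; conditioning on $B^\mu(0)=u$ means that the process is started at $u$, and for $u>v$ the event $\{\min_{0\le z\le t}B^\mu(z)>v\}$ has positive probability and is conditioned on in the elementary sense. Here $\delta$ ranges over small positive numbers with $0<s-\delta$, $s+\delta<t$. The law $P\{\cdot\mid\inf_{0<z<t}B^\mu(z)>v,\ B^\mu(0)=v\}$ is the weak limit on $C[0,t]$, as $u\downarrow v$, of the laws $P\{\cdot\mid\min_{0\le z\le t}B^\mu(z)>v,\ B^\mu(0)=u\}$; its marginal at time $s\in(0,t)$ has density, for $y>v$, $$ \left(\frac ts\right)^{3/2}\frac{(y-v)e^{-\frac{(y-v)^2}{2s}}}{\int_0^\infty we^{-\frac{w^2}{2t}+\mu w}\,\mathrm dw}\int_0^\infty\left(e^{-\frac{(w-(y-v))^2}{2(t-s)}}-e^{-\frac{(w+(y-v))^2}{2(t-s)}}\right)\frac{e^{\mu w}}{\sqrt{2\pi(t-s)}}\,\mathrm dw . $$ *)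

(* Defs.v *)
From HB Require Import structures.
From mathcomp Require Import all_boot all_order all_algebra.
From mathcomp Require Import all_classical all_reals all_analysis.

Set Implicit Arguments.
Unset Strict Implicit.
Unset Printing Implicit Defensive.

Import Order.TTheory GRing.Theory Num.Theory.
Import numFieldNormedType.Exports.

Local Open Scope classical_set_scope.
Local Open Scope ring_scope.

Definition time_interval (R : realType) (t : R) : set R := `[0, t].

(* C[0,t] with the topology of uniform convergence; as the domain of a path,
   [time_interval t] is the subtype [set_type]. *)
Definition path_space (R : realType) (t : R) : Type :=
  continuousType (time_interval t) R.

HB.instance Definition _ (R : realType) (t : R) :=
  PseudoMetric.copy (path_space t)
    (initial_topology
       (fun x : path_space t => (x : arrow_uniform_type (time_interval t) R))).

HB.instance Definition _ (R : realType) (t : R) :=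
  isPointed.Build (path_space t) (cst 0 : continuousType (time_interval t) R).

Definition borel_path_space (R : realType) (t : R) :=
  g_sigma_algebraType (@open (path_space t)).

Section brownian.
Context (R : realType) (d : measure_display) (T : measurableType d)
  (P : probability T R).

Definition increment (B : R -> {RV P >-> R}) (a b : R) : T -> R :=
  fun w => B b w - B a w.

(* Only the times z >= 0 are constrained. [normal_prob m sigma] is
   parametrized by the standard deviation. Subfamilies in the product rule
   are covered by taking some [A i] to be [setT]. *)
Record standard_brownian_motion (B : R -> {RV P >-> R}) : Prop := {
  bm_start : {ae P, forall w, B 0 w = 0} ;
  bm_continuous : forall w, {within `[(0 : R), +oo[, continuous (B ^~ w)} ;
  bm_gaussian : forall a b : R, 0 <= a -> a < b ->
    forall A : set R, measurable A ->
      P (increment B a b @^-1` A) = normal_prob 0 (Num.sqrt (b - a)) A ;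
  bm_independent : forall (n : nat) (tau : nat -> R),
    0 <= tau 0%N -> (forall i, (i < n)%N -> tau i <= tau i.+1) ->
    forall A : 'I_n -> set R, (forall i, measurable (A i)) ->
      P [set w | forall i : 'I_n, A i (increment B (tau i) (tau i.+1) w)] =
      (\prod_(i < n) P (increment B (tau i) (tau i.+1) @^-1` A i))%E }.

(* B^mu under the condition B^mu(0) = u *)
Definition drifted (B : R -> {RV P >-> R}) (mu u z : R) (w : T) : R :=
  u + B z w + mu * z.

Lemma drifted_continuous (B : R -> {RV P >-> R}) (mu u t : R) (w : T) :
  standard_brownian_motion B ->
  continuous (fun z : time_interval t => drifted B mu u (set_val z) w).
Proof.
move=> hB z.
have cB : {within time_interval t, continuous (B ^~ w)}.
  apply: (continuous_subspaceW _ (@bm_continuous _ hB w)) => x /=.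
  by rewrite /time_interval/= !in_itv/= andbT => /andP[].
have cv : {for z, continuous (set_val : time_interval t -> R)}.
  exact: initial_continuous.
have cBz : (fun x : time_interval t => B (set_val x) w) @ z --> B (set_val z) w.
  exact: (iffLR (subspace_sigL_continuousP _ (B ^~ w)) cB z).
have cc (c : R) : (fun _ : time_interval t => c) @ z --> c.
  exact: (@cvg_cst R c _ (nbhs z) _).
exact: (cvgD (cvgD (cc u) cBz) (cvgM (cc mu) cv)).
Qed.

Definition drifted_path (B : R -> {RV P >-> R})
    (hB : standard_brownian_motion B) (mu u t : R) (w : T) : path_space t :=
  mkcts (@drifted_continuous B mu u t w hB).

(* The paths are continuous, so the infimum is attained: it is the minimum. *)
Definition stays_above (B : R -> {RV P >-> R}) (mu v t u : R) : set T :=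
  [set w | v < inf [set drifted B mu u z w | z in time_interval t]].

(* Likewise the supremum is the maximum. *)
Definition window_bounded (B : R -> {RV P >-> R}) (mu s delta eta u : R)
    : set T :=
  [set w | sup [set `|drifted B mu u z w| | z in `[s - delta, s + delta]]
           <= eta].

(* Elementary conditioning, meaningful when P C > 0. *)
Definition cond_prob (A C : set T) : R := fine (P (A `&` C)) / fine (P C).

Definition cond_expectation (f : T -> R) (C : set T) : R :=
  (\int[P]_(w in C) f w) / fine (P C).

(* Q is the law P{. | inf_{0<z<t} B^mu(z) > v, B^mu(0) = v} on C[0,t]: the weak
   limit, as u decreases to v, of the conditional laws of the path of B^mu
   started at u, integrals against those laws being written on T. *)
Definition conditioned_law (B : R -> {RV P >-> R})
    (hB : standard_brownian_motion B) (mu v t : R)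
    (Q : probability (borel_path_space t) R) : Prop :=
  forall F : path_space t -> R, continuous F -> bounded_fun F ->
    cond_expectation (F \o drifted_path hB mu u t) (stays_above B mu v t u)
      @[u --> v^'+] --> \int[Q]_x F x.

End brownian.

(* Main.v *)
Require Import Defs.
From HB Require Import structures.
From mathcomp Require Import all_boot all_order all_algebra.
From mathcomp Require Import all_classical all_reals all_analysis.
From mathcomp Require Import measurable_realfun lra zify ring.

Set Implicit Arguments.
Unset Strict Implicit.
Unset Printing Implicit Defensive.

Import Order.TTheory GRing.Theory Num.Theory.
Import numFieldNormedType.Exports.

Local Open Scope classical_set_scope.
Local Open Scope ring_scope.

(** The proof is a portmanteau argument.  Let M be the maximum of the path over
    a window [a, b] with 0 < a.  It is a continuous functional of the path, so
    its conditional distribution functions converge to that under the limit law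
    Q wherever the latter is continuous; on the conditioning event the absolute
    value in the window changes nothing, because v > 0.  When the window shrinks
    to s, M decreases to the value of the path at s.  What has to be excluded is
    that M, or the value at s, has an atom at eta under Q, and this follows from
    an estimate that is uniform in the starting point u > v:

      P{x < M <= y, the path stays above v}
        <= C (y - x) P{the path stays above v}

    ([stays_above_small_ball]).  It has two ingredients, and neither of them
    computes a density of the conditioned process.

    - Decoupling ([small_ball]).  Put p = a / 2.  The increment over [p, a] is
      normal and independent of all the other increments, and M is the sum of
      this increment and of a function of the others.  So whatever the others
      do, M falls into ]x, y] with probability at most y - x times the peak of a
      normal density.  Retaining only the survival up to time p, one obtains the
      estimate with survival up to p on the right-hand side.

    - Survival up to p is at most a constant times more likely than survival up
      to t, uniformly in u ([survival_ratio]).  Given survival up to p, the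
      position at time p is stochastically larger than the unconditioned one
      ([walk_above_dominates]).  Hence it exceeds its starting point by k with a
      conditional probability that is bounded below, and for k large the later
      increments stay above -k with positive probability, independently.

    Both are first proved for the random walk that the path performs on a dyadic
    grid, where they only involve finitely many independent increments; path
    continuity then carries them over to all times. *)

(** * Independence and joint laws *)

Lemma measurable_ge (R : realType) (d : measure_display)
    (T : measurableType d) (f : T -> R) (y : R) :
  measurable_fun setT f -> measurable [set w | y <= f w].
Proof.
move=> mf; rewrite (_ : [set _ | _] = f @^-1` `[y, +oo[).
  by rewrite -[X in measurable X]setTI; exact: mf.
by apply/seteqP; split => w /=; rewrite in_itv/= andbT.
Qed.

Section independence.
Context (R : realType) (d : measure_display) (T : measurableType d)
  (P : probability T R).
Local Open Scope ereal_scope.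

(** For fixed F both sides are finite measures in E, so that agreement on a
    pi-system propagates to the generated sigma-algebra. *)
Lemma indep_g_sigma_algebra (G : set (set T)) (F : set T) :
  setI_closed G -> G `<=` measurable -> G setT -> measurable F ->
  (forall E, G E -> P (E `&` F) = P E * P F) ->
  forall E, <<s G >> E -> P (E `&` F) = P E * P F.
Proof.
move=> IG mG GT mF GF E GE.
have PF0 : (0 <= fine (P F))%R by exact: fine_ge0.
pose m2 := mscale (NngNum PF0) P.
have m2E A : m2 A = P A * P F.
  by rewrite /m2 /mscale/= muleC fineK// fin_num_measure.
rewrite -(m2E E) -[LHS]/(mrestr P mF E).
apply: (g_sigma_algebra_measure_unique G mG (fun=> setT)) => //.
- by rewrite bigcup_const//; exists 0%N.
- by move=> A GA; exact: etrans (GF _ GA) (esym (m2E A)).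
- by move=> k; rewrite -ge0_fin_numE//; exact: fin_num_measure.
Qed.

Lemma indep_g_sigma_algebra2 (G H : set (set T)) :
  setI_closed G -> G `<=` measurable -> G setT ->
  setI_closed H -> H `<=` measurable -> H setT ->
  (forall E F, G E -> H F -> P (E `&` F) = P E * P F) ->
  forall E F, <<s G >> E -> <<s H >> F -> P (E `&` F) = P E * P F.
Proof.
move=> IG mG GT IH mH HT GH E F sE sF.
have mE : measurable E.
  exact: (smallest_sub (@sigma_algebra_measurable _ T) mG).
rewrite setIC muleC; apply: (indep_g_sigma_algebra (G := H)) => // F' HF'.
rewrite setIC muleC; apply: (indep_g_sigma_algebra (G := G)) => //.
  exact: mH.
by move=> E' GE'; exact: GH.
Qed.

Section law_on.
Context (d' : measure_display) (T' : measurableType d').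

(** The measurability proofs are arguments of the definition so that its measure
    structure can be inferred from the term alone. *)
Definition law_on (E : set T) (mE : measurable E) (Z : T -> T')
    (mZ : measurable_fun setT Z) : set T' -> \bar R :=
  fun U => P (E `&` Z @^-1` U).

Context (E : set T) (mE : measurable E) (Z : T -> T')
  (mZ : measurable_fun setT Z).

Let mEZ U : measurable U -> measurable (E `&` Z @^-1` U).
Proof.
move=> mU; apply: measurableI => //.
by rewrite -[X in measurable X]setTI; exact: mZ.
Qed.

Let law0 : law_on mE mZ set0 = 0.
Proof. by rewrite /law_on preimage_set0 setI0 measure0. Qed.

Let law_ge0 U : 0 <= law_on mE mZ U. Proof. exact: measure_ge0. Qed.

Let law_sigma_additive : semi_sigma_additive (law_on mE mZ).
Proof.
move=> F mF tF mUF; rewrite /law_on preimage_bigcup setI_bigcupr.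
apply: measure_semi_sigma_additive => [n||]; first exact: mEZ.
- apply/trivIsetP => /= i j _ _ ij; rewrite setIACA setIid -preimage_setI.
  by move/trivIsetP : tF => /(_ _ _ _ _ ij) ->//; rewrite preimage_set0 setI0.
- by rewrite -setI_bigcupr -preimage_bigcup; exact: mEZ.
Qed.

HB.instance Definition _ := isMeasure.Build _ _ _
  (law_on mE mZ) law0 law_ge0 law_sigma_additive.

Let law_fin : fin_num_fun (law_on mE mZ).
Proof. by move=> U mU; apply: fin_num_measure; exact: mEZ. Qed.

HB.instance Definition _ :=
  @Measure_isFinite.Build _ _ R (law_on mE mZ) law_fin.

End law_on.

Section joint_law.
Context (E : set T) (mE : measurable E) (X Y : T -> R)
  (mX : measurable_fun setT X) (mY : measurable_fun setT Y).
Hypothesis indepXY : forall U V : set R, measurable U -> measurable V ->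
  P (E `&` Y @^-1` U `&` X @^-1` V) = P (E `&` Y @^-1` U) * P (X @^-1` V).

Let lawE : {finite_measure set R -> \bar R} := law_on mE mY.
Let lawX : {finite_measure set R -> \bar R} := law_on (@measurableT _ T) mX.

(** By independence the two sides, as measures in W, agree on rectangles. *)
Lemma joint_law (W : set (R * R)) : measurable W ->
  P (E `&` [set w | W (Y w, X w)]) = (lawE \x lawX) W.
Proof.
move=> mW; apply/esym.
have mYX : measurable_fun setT (fun w => (Y w, X w)).
  exact: measurable_fun_pair.
pose m' : {measure set (R * R) -> \bar R} := law_on mE mYX.
apply: (product_measure_unique (m' := m')) => // U V mU mV.
rewrite /= /law_on setTI -indepXY//; congr (P _).
by apply/seteqP; split=> w /=; [move=> [? []]|move=> [[]]].
Qed.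

Lemma joint_law_integral (W : set (R * R)) : measurable W ->
  P (E `&` [set w | W (Y w, X w)]) =
  \int[law_on (@measurableT _ T) mX]_x P (E `&` [set w | W (Y w, x)]).
Proof.
move=> mW; rewrite joint_law//.
have -> : (lawE \x lawX) W = (lawE \x^ lawX) W.
  apply: (product_measure_unique) => // U V mU mV.
  exact: (product_measure2E lawE lawX).
apply: eq_integral => x _ /=; rewrite /law_on; congr (P (_ `&` _)).
by apply/seteqP; split=> w /=; rewrite /ysection/= inE.
Qed.

(** Integrating over the value y of Y first: every section of W weighs at most c
    for the law of X. *)
Lemma joint_law_le (W : set (R * R)) (c : R) : measurable W -> (0 <= c)%R ->
  (forall y, P [set w | W (y, X w)] <= c%:E) ->
  P (E `&` [set w | W (Y w, X w)]) <= c%:E * P E.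
Proof.
move=> mW c0 Wc; rewrite joint_law//.
apply: (@le_trans _ _ (\int[lawE]_y c%:E)); last first.
  by rewrite integral_cst//= /law_on preimage_setT setIT.
apply: ge0_le_integral => //=.
- exact: measurable_fun_xsection.
- move=> y _; rewrite /law_on setTI; apply: le_trans (Wc y).
  by rewrite le_eqVlt; apply/orP; left; apply/eqP; congr (P _);
    apply/seteqP; split=> w /=; rewrite /xsection/= inE.
Qed.

End joint_law.
End independence.

(** * Random walks with independent steps above a moving barrier *)

Section independent_steps.
Context (R : realType) (d : measure_display) (T : measurableType d)
  (P : probability T R).
Context (X : nat -> T -> R) (mX : forall i, measurable_fun setT (X i)) (n : nat).
Hypothesis indepX : forall A : 'I_n -> set R, (forall i, measurable (A i)) ->
  (P [set w | forall i : 'I_n, A i (X i w)] =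
   \prod_(i < n) P (X i @^-1` A i))%E.

(** The pi-system generating the sigma-algebra of the steps with index in I. *)
Definition rectangles (I : pred nat) : set (set T) :=
  [set E | exists2 A : 'I_n -> set R,
     forall i, measurable (A i) /\ (~~ I i -> A i = setT) &
     E = [set w | forall i : 'I_n, A i (X i w)]].

Lemma setI_closed_rectangles I : setI_closed (rectangles I).
Proof.
move=> _ _ [A mA ->] [A' mA' ->]; exists (fun i => A i `&` A' i).
  move=> i; split; first by apply: measurableI; [apply: (mA i).1|apply: (mA' i).1].
  by move=> Ii; rewrite (mA i).2// (mA' i).2// setIT.
apply/seteqP; split=> w /=; first by move=> [h h'] i; split.
by move=> h; split=> i; case: (h i).
Qed.

Let mXV i V : measurable V -> measurable (X i @^-1` V).
Proof. by move=> mV; rewrite -[X in measurable X]setTI; exact: mX. Qed.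

Lemma measurable_rectangles I : rectangles I `<=` measurable.
Proof.
move=> _ [A mA ->].
rewrite (_ : [set _ | _] = \bigcap_(i : 'I_n) (X i @^-1` A i)); last first.
  by apply/seteqP; split=> w /= h i => [_|]; exact: h.
apply: fin_bigcap_measurable; first exact: finite_finset.
by move=> i _; apply: mXV; case: (mA i).
Qed.

Lemma rectanglesT I : rectangles I setT.
Proof. by exists (fun=> setT) => //; apply/seteqP; split. Qed.

Lemma rectangles_step (I : pred nat) i V : (i < n)%N -> I i -> measurable V ->
  rectangles I (X i @^-1` V).
Proof.
move=> ltin Ii mV; exists (fun j : 'I_n => if j == i :> nat then V else setT).
  move=> j; split; first by case: ifP.
  by case: eqP => // ->; rewrite Ii.
apply/seteqP; split => w /=; first by move=> Vw j; case: eqP => // ->.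
by move=> /(_ (Ordinal ltin)) /=; rewrite eqxx.
Qed.

Lemma indep_rectangles I E F :
  <<s rectangles I>> E -> <<s rectangles (predC I)>> F ->
  (P (E `&` F) = P E * P F)%E.
Proof.
apply: indep_g_sigma_algebra2; try exact: setI_closed_rectangles;
  try exact: measurable_rectangles; try exact: rectanglesT.
move=> _ _ [A mA ->] [A' mA' ->].
rewrite (indepX (fun i => (mA i).1)) (indepX (fun i => (mA' i).1)).
rewrite -big_split/= (_ : _ `&` _ =
    [set w | forall i : 'I_n, (A i `&` A' i) (X i w)]); last first.
  apply/seteqP; split=> w /=; first by move=> [h h'] i; split.
  by move=> h; split=> i; case: (h i).
rewrite (indepX (fun i => measurableI _ _ (mA i).1 (mA' i).1)).
apply: eq_bigr => i _; rewrite preimage_setI.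
have [Ii|Ii] := boolP (I i).
  by rewrite (mA' i).2 /= ?Ii// preimage_setT setIT probability_setT mule1.
by rewrite (mA i).2// preimage_setT setTI probability_setT mul1e.
Qed.

Definition step_sigma (I : pred nat) := g_sigma_algebraType (rectangles I).

Definition walk k (w : T) : R := \sum_(i < k) X i w.

Lemma measurable_walk k : measurable_fun setT (walk k).
Proof. exact: measurable_sum. Qed.

Lemma walkS k w : walk k.+1 w = walk k w + X k w.
Proof. by rewrite /walk big_ord_recr. Qed.

Lemma measurable_step_sigma (I : pred nat) (E : set T) :
  measurable (E : set (step_sigma I)) -> measurable E.
Proof.
exact: (smallest_sub (@sigma_algebra_measurable _ T) (@measurable_rectangles I)).
Qed.

Lemma measurable_fun_step_sigma (I : pred nat) i : (i < n)%N -> I i ->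
  measurable_fun setT (X i : step_sigma I -> R).
Proof.
move=> ltin Ii _ V mV; rewrite setTI.
by apply: sub_sigma_algebra; exact: rectangles_step.
Qed.

Lemma measurable_walk_sigma (I : pred nat) i j : (j <= n)%N ->
  (forall k, (i <= k < j)%N -> I k) -> (i <= j)%N ->
  measurable_fun setT ((fun w => walk j w - walk i w) : step_sigma I -> R).
Proof.
move=> + + ij; elim: j ij => [|j IH].
  rewrite leqn0 => /eqP -> _ _.
  rewrite (_ : (fun w => _) = cst 0)//; apply/funext => w /=.
  by rewrite subrr.
rewrite leq_eqVlt => /predU1P[<- _ _|ij jn Ijk].
  rewrite (_ : (fun w => _) = cst 0)//; apply/funext => w /=.
  by rewrite subrr.
rewrite (_ : (fun w => _) = ((fun w => walk j w - walk i w) \+ X j)); last first.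
  by apply/funext => w /=; rewrite walkS addrAC.
apply: measurable_funD.
  apply: IH => //; first exact: ltnW.
  by move=> k /andP[ik kj]; apply: Ijk; rewrite ik ltnS ltnW.
by apply: measurable_fun_step_sigma => //; apply: Ijk; rewrite -ltnS ij/=.
Qed.

Definition walk_above (b : nat -> R) k : set T :=
  [set w | forall j, (j <= k)%N -> b j <= walk j w].

Lemma walk_aboveS b k :
  walk_above b k.+1 = walk_above b k `&` [set w | b k.+1 <= walk k.+1 w].
Proof.
apply/seteqP; split=> w /=.
  by move=> h; split; [move=> j jk; exact/h/leqW|exact: h].
move=> [h hk] j; rewrite leq_eqVlt => /predU1P[->//|]; exact: h.
Qed.

Lemma walk_above0 b : walk_above b 0 = [set w | b 0%N <= walk 0 w].
Proof.
by apply/seteqP; split => w /= h; [exact: h|move=> j; rewrite leqn0 => /eqP ->].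
Qed.

Lemma measurable_walk_above_sigma (I : pred nat) b k : (k <= n)%N ->
  (forall j, (j < k)%N -> I j) ->
  measurable (walk_above b k : set (step_sigma I)).
Proof.
move=> kn Ik.
have ml j : (j <= k)%N ->
    measurable ([set w | b j <= walk j w] : set (step_sigma I)).
  move=> jk; rewrite (_ : [set _ | _] = (fun w => walk j w - walk 0 w) @^-1` `[b j, +oo[).
    rewrite -[X in measurable X]setTI; apply: measurable_walk_sigma => //.
    - exact: leq_trans kn.
    - by move=> i ij; apply: Ik; exact: leq_trans jk.
  by apply/seteqP; split => w /=; rewrite /walk !big_ord0 subr0 in_itv/= andbT.
elim: k {kn Ik} ml => [|k IH] ml; first by rewrite walk_above0; exact: ml.
rewrite walk_aboveS; apply: measurableI; last exact: ml.
by apply: IH => j jk; apply: ml; exact: leqW.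
Qed.

Lemma indep_walk_step k (E : set T) U V : (k < n)%N ->
  measurable (E : set (step_sigma (fun i => (i < k)%N))) ->
  measurable U -> measurable V ->
  (P (E `&` walk k @^-1` U `&` X k @^-1` V) =
   P (E `&` walk k @^-1` U) * P (X k @^-1` V))%E.
Proof.
move=> kn mE mU mV; apply: (@indep_rectangles (fun i => (i < k)%N)).
  apply: (@measurableI _ (step_sigma (fun i => (i < k)%N))) => //.
  rewrite (_ : _ @^-1` _ = (fun w => walk k w - walk 0 w) @^-1` U).
    rewrite -[X in measurable X]setTI; apply: measurable_walk_sigma => //.
    exact: ltnW.
  by apply/seteqP; split => w /=; rewrite /walk !big_ord0 subr0.
by apply: sub_sigma_algebra; apply: rectangles_step => //=; rewrite ltnn.
Qed.

Lemma measurable_walk_above b k : measurable (walk_above b k).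
Proof.
have ml j : measurable [set w | b j <= walk j w].
  rewrite (_ : [set _ | _] = walk j @^-1` `[b j, +oo[).
    by rewrite -[X in measurable X]setTI; apply: measurable_walk.
  by apply/seteqP; split => w /=; rewrite in_itv/= andbT.
elim: k => [|k IH]; first by rewrite walk_above0; exact: ml.
by rewrite walk_aboveS; apply: measurableI.
Qed.

(** Conditioning on the value x of the new step turns both sides into tail
    probabilities of the previous position at level y - x, so that an independent
    step preserves the domination. *)
Lemma walk_above_step b k (y : R) : (k < n)%N ->
  (forall z : R, P (walk_above b k) * P [set w | (z <= walk k w)%R] <=
     P (walk_above b k `&` [set w | (z <= walk k w)%R]))%E ->
  (P (walk_above b k) * P [set w | (y <= walk k.+1 w)%R] <=
     P (walk_above b k `&` [set w | (y <= walk k.+1 w)%R]))%E.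
Proof.
move=> kn IH.
have mW : measurable [set ax : R * R | y <= ax.1 + ax.2].
  rewrite (_ : [set _ | _] = (fun ax : R * R => ax.1 + ax.2) @^-1` `[y, +oo[).
    rewrite -[X in measurable X]setTI; apply: measurable_funD => //.
  by apply/seteqP; split => w /=; rewrite in_itv/= andbT.
have mA := measurable_walk_above b k.
have EW (E : set T) : E `&` [set w | (y <= walk k.+1 w)%R] =
    E `&` [set w | [set ax : R * R | y <= ax.1 + ax.2] (walk k w, X k w)].
  by apply/seteqP; split => w /=; rewrite walkS.
rewrite EW (joint_law_integral mA (mX k) (measurable_walk k))//; last first.
  move=> U V mU mV; apply: indep_walk_step => //.
  by apply: measurable_walk_above_sigma => //; exact: ltnW.
rewrite -[[set w | (y <= walk k.+1 w)%R]]setTI EW.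
rewrite (joint_law_integral measurableT (mX k) (measurable_walk k))//; last first.
  by move=> U V mU mV; apply: indep_walk_step.
have mS (E : set T) (mE : measurable E) : measurable_fun [set: R]
    (fun x => P (E `&` [set w | y <= walk k w + x])).

  have := measurable_fun_ysection (law_on P mE (measurable_walk k)) mW.
  rewrite /law_on /comp => h; apply: eq_measurable_fun h => x _; congr (P (_ `&` _)).
  by apply/seteqP; split => w /=; rewrite /ysection/= inE.
rewrite -[P (walk_above b k)]fineK ?fin_num_measure//.
rewrite -ge0_integralZl//; [|by apply: mS|by rewrite lee_fin fine_ge0].
apply: ge0_le_integral => //.
- by move=> x _; rewrite mule_ge0// lee_fin fine_ge0.
- by apply: measurable_funeM; exact: mS.
- exact: mS.
- move=> x _; rewrite fineK ?fin_num_measure// setTI.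
  rewrite (_ : [set w | y <= walk k w + x] = [set w | y - x <= walk k w]).
    exact: IH.
  by apply/seteqP; split => w /=; rewrite lerBlDr.
Qed.

(** Given that the walk has respected the barrier, its position is stochastically
    larger than the unconditioned one.  By induction: a new independent step
    preserves this, and so does conditioning the new position to lie in the
    half-line above the barrier.  It is an instance of the Harris inequality for
    increasing events, obtained with integrals in one variable only. *)
Lemma walk_above_dominates b k (y : R) : (k <= n)%N ->
  (P (walk_above b k) * P [set w | (y <= walk k w)%R] <=
     P (walk_above b k `&` [set w | (y <= walk k w)%R]))%E.
Proof.
elim: k y => [|k IH] y kn.
  have [y0|y0] := boolP (y <= 0).
    rewrite (_ : [set w | y <= _] = setT).
      by rewrite probability_setT mule1 setIT.
    by apply/seteqP; split => w //=; rewrite /walk big_ord0.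
  rewrite (_ : [set w | y <= _] = set0).
    by rewrite measure0 mule0.
  by apply/seteqP; split => w //=; rewrite /walk big_ord0 (negPf y0).
have ml : measurable [set w | y <= walk k.+1 w] by apply: measurable_ge; exact: measurable_walk.
(* a level y under the barrier is exceeded by every surviving walk *)
have [yb|yb] := leP y (b k.+1).
  rewrite (setIidl _); last first.
    by rewrite walk_aboveS => w [_ /=]; exact: le_trans.
  rewrite -[leRHS]mule1; apply: lee_wpmul2l => //.
  exact: probability_le1.
have bw : walk_above b k.+1 `&` [set w | y <= walk k.+1 w] =
    walk_above b k `&` [set w | y <= walk k.+1 w].
  rewrite walk_aboveS -setIA; congr (_ `&` _); apply: setIidr => w /=.
  exact/le_trans/ltW.
rewrite bw; apply: le_trans (@walk_above_step b k y kn _); last first.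
  by move=> z; apply: IH; exact: ltnW.
apply: lee_wpmul2r => //; apply: le_measure; rewrite ?inE.
- exact: measurable_walk_above.
- exact: measurable_walk_above.
- by rewrite walk_aboveS => w [].
Qed.

End independent_steps.

(** * Continuous paths observed on dyadic grids *)

Section dyadic_grid.
Context (R : realType).
Implicit Types (a b c z : R) (f : R -> R).

Definition dyadic a b n j : R := a + (b - a) * (j%:R / 2 ^+ n).

Lemma dyadic_itv a b n j : a <= b -> (j <= 2 ^ n)%N -> dyadic a b n j \in `[a, b].
Proof.
move=> ab jn; rewrite in_itv/= /dyadic.
have x0 : 0 <= j%:R / 2 ^+ n :> R by rewrite divr_ge0// exprn_ge0.
have x1 : j%:R / 2 ^+ n <= 1 :> R.
  by rewrite ler_pdivrMr ?exprn_gt0// mul1r -natrX ler_nat.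
by apply/andP; split; nra.
Qed.

Lemma dyadic_double a b n j : dyadic a b n.+1 j.*2 = dyadic a b n j.
Proof.
rewrite /dyadic -muln2 natrM exprSr; congr (_ + _ * _).
by rewrite invfM mulrACA divff// mulr1.
Qed.

Lemma dyadic_dense a b f c z : {within `[a, b], continuous f} -> z \in `[a, b] ->
  (forall n j, (j <= 2 ^ n)%N -> c <= f (dyadic a b n j)) -> c <= f z.
Proof.
move=> cf zab fc.
have /andP[az zb] : a <= z <= b by rewrite in_itv/= in zab.
pose x := (z - a) / (b - a).
have x0 : 0 <= x by rewrite divr_ge0// subr_ge0// (le_trans az).
have x1 : x <= 1.
  rewrite /x; have [ab|ab] := ltP a b.
    by rewrite ler_pdivrMr ?subr_gt0// mul1r lerB.
  have -> : z = a by lra.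
  by rewrite subrr mul0r.
have zx : z = a + (b - a) * x.
  rewrite /x; have [ab|ab] := ltP a b.
    by rewrite mulrCA divff ?gt_eqF ?subr_gt0// mulr1; lra.
  have -> : z = a by lra.
  by rewrite subrr mul0r mulr0 addr0.
(* j n is the index of the last grid point up to z *)
pose j n := Num.truncn (x * 2 ^+ n).
have jn n : (j n <= 2 ^ n)%N.
  rewrite -(ler_nat R) natrX; apply: (@le_trans _ _ (x * 2 ^+ n)).
    by rewrite truncn_le mulr_ge0// exprn_ge0.
  by rewrite ler_piMl// exprn_ge0.
have jx : (fun n => (j n)%:R / 2 ^+ n) @ \oo --> x.
  apply: (@squeeze_cvgr _ _ _ _ (fun n => x - 2^-1 ^+ n) (fun=> x)); last 2 first.
  - rewrite -[X in _ --> X]subr0; apply: cvgB; first exact: cvg_cst.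
    by apply: cvg_expr; rewrite ger0_norm ?invr_ge0// invf_lt1// ltr1n.
  - exact: cvg_cst.
  apply: nearW => n; apply/andP; split; last first.
    by rewrite ler_pdivrMr ?exprn_gt0// truncn_le mulr_ge0// exprn_ge0.
  rewrite ler_pdivlMr ?exprn_gt0// mulrBl -exprMn mulVf// expr1n lerBlDr.
  by rewrite natr1 ltW// truncnS_gt.
have gz : (fun n => dyadic a b n (j n)) @ \oo --> z.
  rewrite [in X in _ --> X]zx; apply: cvgD; first exact: cvg_cst.
  by apply: cvgM => //; exact: cvg_cst.
have ab := le_trans az zb.
have fgz : (fun n => f (dyadic a b n (j n))) @ \oo --> f z.
  apply: (cvg_comp (fun n => dyadic a b n (j n)) f); last first.
    by apply: ((subspace_continuousP _ _).1 cf).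
  move=> U UU; have : \forall n \near \oo,
      dyadic a b n (j n) \in `[a, b] -> U (dyadic a b n (j n)) by exact: gz UU.
  by apply: filterS => n; apply; exact: dyadic_itv ab (jn n).
by apply: (cvgr_to_ge fgz); apply: nearW => n; exact: fc.
Qed.

End dyadic_grid.

Section path_events.
Context (R : realType) (d : measure_display) (T : measurableType d).
Implicit Types (f : R -> T -> R) (a b c : R) (n : nat).

(** Upper bounds on a path are lower bounds on its opposite, so that one family of
    events, [above], serves for minima and maxima. *)
Definition opp_path f : R -> T -> R := fun z w => - f z w.

Definition above f a b c : set T :=
  [set w | forall z, z \in `[a, b] -> c <= f z w].

Definition above_grid f a b c n : set T :=
  [set w | forall j, (j <= 2 ^ n)%N -> c <= f (dyadic a b n j) w].

Lemma above_grid_nonincreasing f a b c :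
  nonincreasing_seq (above_grid f a b c).
Proof.
apply/nonincreasing_seqP => n; apply/subsetPset => w h j jn.
rewrite -dyadic_double; apply: h.
by rewrite expnS mul2n leq_double.
Qed.

Lemma above_sub_grid f a b c n : a <= b -> above f a b c `<=` above_grid f a b c n.
Proof. by move=> ab w h j jn; apply: h; exact: dyadic_itv. Qed.

Lemma bigcap_above_grid f a b c : a <= b ->
  (forall w, {within `[a, b], continuous (f ^~ w)}) ->
  \bigcap_n above_grid f a b c n = above f a b c.
Proof.
move=> ab cf; apply/seteqP; split=> w.
  by move=> h z zab; apply: (dyadic_dense (cf w) zab) => n j jn; exact: h.
by move=> h n _; exact: above_sub_grid.
Qed.

Lemma measurable_above_grid f a b c n :
  (forall j, (j <= 2 ^ n)%N -> measurable_fun setT (f (dyadic a b n j))) ->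
  measurable (above_grid f a b c n).
Proof.
move=> mf; rewrite (_ : above_grid _ _ _ _ _ =
    \bigcap_(j in `I_(2 ^ n).+1) (f (dyadic a b n j) @^-1` `[c, +oo[)).
  apply: fin_bigcap_measurable; first exact: finite_II.
  by move=> j jn; rewrite -[X in measurable X]setTI; exact: mf.
by apply/seteqP; split=> w /= h j /=; [rewrite in_itv/= andbT => ?; exact: h|
  move=> jn; have := h j jn; rewrite /= in_itv/= andbT].
Qed.

Lemma measurable_above f a b c : a <= b -> (forall z, measurable_fun setT (f z)) ->
  (forall w, {within `[a, b], continuous (f ^~ w)}) ->
  measurable (above f a b c).
Proof.
move=> ab mf cf; rewrite -bigcap_above_grid//.
by apply: bigcap_measurable; [exact: (ex_intro _ 0%N)|
  move=> n _; exact: measurable_above_grid].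
Qed.

End path_events.

(** * Bounds on normal probabilities *)

Lemma normal_prob_itv_le (R : realType) (m sigma a b : R) : sigma != 0 -> a <= b ->
  (normal_prob m sigma `[a, b] <= (normal_peak sigma * (b - a))%:E)%E.
Proof.
move=> s0 ab; rewrite /normal_prob.
apply: (@le_trans _ _ (\int[lebesgue_measure]_(x in `[a, b]) (normal_peak sigma)%:E)%E).
  apply: ge0_le_integral => //=.
  - by move=> x _; rewrite lee_fin normal_pdf_ge0.
  - by apply/measurable_EFinP; apply: measurable_funTS; exact: measurable_normal_pdf.
  - by move=> x _; rewrite lee_fin normal_pdf_ub.
rewrite integral_cst//= lebesgue_measure_itv/= lte_fin.
have [->|ba] := eqVneq a b; first by rewrite ltxx subrr mulr0 mule0.
by rewrite lt_neqAle ba ab/= EFinM.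
Qed.

Lemma normal_prob_itv_gt0 (R : realType) (m sigma a b : R) : sigma != 0 -> a < b ->
  (0 < normal_prob m sigma `[a, b])%E.
Proof.
(* by convexity M bounds the squared distance to m on the whole interval *)
move=> s0 ab; pose M := (a - m) ^+ 2 + (b - m) ^+ 2.
pose e := normal_peak sigma * expR (- M / (sigma ^+ 2 *+ 2)).
have e0 : 0 < e by rewrite mulr_gt0 ?expR_gt0// normal_peak_gt0.
have s2 : 0 < sigma ^+ 2 *+ 2 by rewrite pmulrn_lgt0// exprn_even_gt0.
apply: (@lt_le_trans _ _ (\int[lebesgue_measure]_(x in `[a, b]) e%:E)%E).
  rewrite integral_cst//= lebesgue_measure_itv/= lte_fin ab.
  by rewrite lte_fin mulr_gt0// subr_gt0.
rewrite /normal_prob; apply: ge0_le_integral => //=.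
- by move=> x _; rewrite lee_fin ltW.
- by apply/measurable_EFinP; apply: measurable_funTS; exact: measurable_normal_pdf.
- move=> x /=; rewrite in_itv/= => /andP[ax xb].
  rewrite lee_fin normal_pdfE// ler_wpM2l ?normal_peak_ge0//.
  rewrite /normal_fun ler_expR ler_pM2r ?invr_gt0// lerN2 /M.
  have [mx|xm] := leP m x.
    have : 0 <= (b - x) * ((b - m) + (x - m)) by apply: mulr_ge0; lra.
    have := sqr_ge0 (a - m); rewrite !expr2; nra.
  have : 0 <= (x - a) * ((m - a) + (m - x)) by apply: mulr_ge0; lra.
  have := sqr_ge0 (b - m); rewrite !expr2; nra.
Qed.

(** * Survival and maxima of Brownian motion with drift *)

(** The times of a walk that goes from 0 to p in 2 ^ n steps, from p to q in a
    single step, and from q to r in 2 ^ n steps. *)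
Definition two_grids (R : realType) (p q r : R) n i : R :=
  if (i <= 2 ^ n)%N then dyadic 0 p n i else dyadic q r n (i - (2 ^ n).+1).

Section two_grids.
Context (R : realType) (p q r : R) (n : nat).
Hypotheses (p0 : 0 <= p) (pq : p <= q) (qr : q <= r).

Lemma dyadic0 (a b : R) m : dyadic a b m 0 = a.
Proof. by rewrite /dyadic mul0r mulr0 addr0. Qed.

Lemma dyadic_last (a b : R) m : dyadic a b m (2 ^ m) = b.
Proof. by rewrite /dyadic natrX divff ?expf_neq0// mulr1 addrC subrK. Qed.

Lemma dyadic_le (a b : R) m i j : a <= b -> (i <= j)%N ->
  dyadic a b m i <= dyadic a b m j.
Proof.
move=> ab ij; rewrite lerD2l ler_wpM2l ?subr_ge0//.
by rewrite ler_wpM2r ?invr_ge0 ?exprn_ge0// ler_nat.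
Qed.

Lemma two_gridsl i : (i <= 2 ^ n)%N -> two_grids p q r n i = dyadic 0 p n i.
Proof. by rewrite /two_grids => ->. Qed.

Lemma two_gridsr j : two_grids p q r n ((2 ^ n).+1 + j) = dyadic q r n j.
Proof. by rewrite /two_grids addSn ltnNge leq_addr/= -addSn addKn. Qed.

Lemma two_grids_nondecreasing i : two_grids p q r n i <= two_grids p q r n i.+1.
Proof.
have [iN|] := ltnP i (2 ^ n).
  by rewrite !two_gridsl ?(ltnW iN)//; apply: dyadic_le.
rewrite leq_eqVlt => /predU1P[<-|Ni].
  rewrite two_gridsl// dyadic_last -[X in two_grids _ _ _ _ X]addn0 two_gridsr.
  by rewrite dyadic0.
rewrite -(subnKC Ni) -addnS !two_gridsr.
exact: dyadic_le.
Qed.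

End two_grids.

Lemma measurable_bigmax (R : realType) (d : measure_display)
    (T : measurableType d) (f0 : T -> R) m (f : nat -> T -> R) :
  measurable_fun setT f0 ->
  (forall j, (j < m)%N -> measurable_fun setT (f j)) ->
  measurable_fun setT (fun w => \big[Num.max/f0 w]_(j < m) f j w).
Proof.
move=> mf0; elim: m f => [|m IH] f mf.
  by under eq_fun do rewrite big_ord0.
under eq_fun do rewrite big_ord_recl.
by apply: measurable_maxr; [exact: mf|apply: (IH (f \o S)) => j; exact: (mf j.+1)].
Qed.

Section brownian_walk.
Context (R : realType) (d : measure_display) (T : measurableType d)
  (P : probability T R) (B : R -> {RV P >-> R})
  (hB : standard_brownian_motion B) (mu : R).
Implicit Types (a c p q r z : R) (n : nat).

(** Subtracting [B 0], which vanishes only almost surely, makes every position a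
    sum of increments. *)
Definition centered z (w : T) : R := B z w - B 0 w + mu * z.

Definition centered_from q z (w : T) : R := centered z w - centered q w.

Lemma measurable_centered z : measurable_fun setT (centered z).
Proof. by apply: measurable_funD => //; exact: measurable_funB. Qed.

Lemma continuous_centered a b w : 0 <= a ->
  {within `[a, b], continuous (centered ^~ w)}.
Proof.
move=> a0.
have cB : {within `[a, b], continuous (B ^~ w)}.
  apply: (continuous_subspaceW _ (@bm_continuous _ _ _ _ _ hB w)) => x /=.
  by rewrite !in_itv/= andbT => /andP[ax _]; exact: le_trans ax.
move=> x; apply: cvgD; first by apply: cvgB; [exact: cB|exact: cvg_cst].
have : {within `[a, b], continuous (fun z => mu * z)}.
  by apply: continuous_subspaceT => y; apply: cvgM; [exact: cvg_cst|exact: cvg_id].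
exact.
Qed.

Section grid_walk.
Context (p q r : R) (n : nat).
Hypotheses (p0 : 0 <= p) (pq : p <= q) (qr : q <= r).

Let N := (2 ^ n)%N.
Let tau := two_grids p q r n.
Let X i : T -> R := increment B (tau i) (tau i.+1).
Let mX i : measurable_fun setT (X i).
Proof. exact: measurable_funB. Qed.

Let indepX (A : 'I_(N.+1 + N) -> set R) : (forall i, measurable (A i)) ->
  (P [set w | forall i : 'I_(N.+1 + N), A i (X i w)] =
   \prod_(i < (N.+1 + N)) P (X i @^-1` A i))%E.
Proof.
move=> mA; apply: (bm_independent hB) => //.
- by rewrite /tau two_gridsl// dyadic0.
- by move=> i _; exact: two_grids_nondecreasing.
Qed.

Let walkE k w : walk X k w = centered (tau k) w - mu * tau k.
Proof.
rewrite /centered addrK; elim: k => [|k IH].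
  by rewrite /walk big_ord0 /tau two_gridsl// dyadic0 subrr.
by rewrite walkS IH /X /increment addrC addrA subrK.
Qed.

Let aboveE c : above_grid centered 0 p c n =
  walk_above X (fun j => c - mu * tau j) N.
Proof.
by apply/seteqP; split=> w /= h j jN; move: (h j jN);
  rewrite /= walkE lerD2r /tau two_gridsl.
Qed.

Let geE k y : [set w | y <= centered (tau k) w] =
  [set w | y - mu * tau k <= walk X k w].
Proof. by apply/seteqP; split=> w /=; rewrite walkE lerD2r. Qed.

Let tauN : tau N = p. Proof. by rewrite /tau two_gridsl// dyadic_last. Qed.
Let tauS j : tau (N.+1 + j) = dyadic q r n j.
Proof. exact: two_gridsr. Qed.

Let tau_incr (I : pred nat) i j : (i <= j)%N -> (j <= N.+1 + N)%N ->
  (forall k, (i <= k < j)%N -> I k) ->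
  measurable_fun setT ((fun w => centered (tau j) w - centered (tau i) w)
    : step_sigma X (N.+1 + N) I -> R).
Proof.
move=> ij jn Iij.
rewrite (_ : (fun w => _) =
  (fun w => walk X j w - walk X i w) \+ cst (mu * tau j - mu * tau i)).
  by apply: measurable_funD => //; exact: measurable_walk_sigma.
by apply/funext => w /=; rewrite !walkE; lra.
Qed.

(** For p = q the middle step is trivial: the second grid only sees steps later
    than p, which are independent of the past, and the past itself is handled by
    the domination of the unconditioned position. *)
Lemma grid_survival c k e : p = q ->
  (P (above_grid centered 0 p c n) * P [set w | (k <= centered p w)%R] *
   P (above_grid (centered_from q) q r e n) <=
   P (above_grid centered 0 p c n `&` [set w | (k <= centered p w)%R] `&`
      above_grid (centered_from q) q r e n))%E.
Proof.
move=> pqE; have NN : (N <= N.+1 + N)%N by lia.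
pose I := fun i => (i < N)%N.
rewrite (@indep_rectangles _ _ _ P X mX (N.+1 + N) indepX I).
- rewrite aboveE -[in [set w | _]]tauN geE; apply: lee_wpmul2r => //.
  exact: (walk_above_dominates mX indepX).
- rewrite aboveE.
  apply: (@measurableI _ (step_sigma X (N.+1 + N) I)).
    exact: measurable_walk_above_sigma.
  rewrite (_ : [set w | _] =
      [set w | k <= centered (tau N) w - centered (tau 0%N) w]).
    by apply: measurable_ge; exact: tau_incr.
  apply/seteqP; split=> w /=; rewrite tauN /tau two_gridsl// dyadic0;
    by rewrite /centered subrr mulr0 addr0 subr0.
- apply: (@measurable_above_grid R _ (step_sigma X (N.+1 + N) (predC I))) => j jN.
  rewrite /centered_from -tauS -pqE -tauN; apply: tau_incr; [lia|rewrite leq_add2l//|].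
  by move=> i /andP[Ni _]; rewrite /= /I -leqNgt.
Qed.

(** The difference of the two events says that the maximum over the second grid
    lies in ]x, y].  This maximum is the increment D over the middle step plus a
    function Y of the other steps; these also determine the event E of survival on
    the first grid, so that the law of D decides. *)
Lemma grid_small_ball c (x y : R) : p < q -> x <= y ->
  (P (above_grid centered 0 p c n `&`
      (above_grid (opp_path centered) q r (- y) n `\`
       above_grid (opp_path centered) q r (- x) n)) <=
   (normal_peak (Num.sqrt (q - p)) * (y - x))%:E *
   P (above_grid centered 0 p c n))%E.
Proof.
move=> ltpq xy; have NN : (N <= N.+1 + N)%N by lia.
pose I := fun i => (i != N)%N.
pose g j w := centered p w + (centered (dyadic q r n j) w - centered q w).
pose Y w := \big[Num.max/g 0%N w]_(j < N.+1) g j w.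
have mg (j : nat) : (j <= N)%N ->
    measurable_fun setT (g j : step_sigma X (N.+1 + N) I -> R).
  move=> jN; rewrite /g; apply: measurable_funD.
    rewrite (_ : centered p = (fun w => centered (tau N) w - centered (tau 0%N) w)).
      by apply: tau_incr => // i /andP[_ iN]; rewrite /I ltn_eqF.
    apply/funext => w; rewrite tauN.
    by rewrite /tau two_gridsl// dyadic0 /centered subrr mulr0 addr0 subr0.
  rewrite -tauS (_ : q = tau N.+1); last first.
    by rewrite -[N.+1]addn0 tauS dyadic0.
  apply: tau_incr; [exact: leq_addr|by rewrite leq_add2l|].
  by move=> i /andP[Ni _]; rewrite /I gtn_eqF.
have mY : measurable_fun setT (Y : step_sigma X (N.+1 + N) I -> R).
  by apply: measurable_bigmax; [exact: mg|move=> j jN; exact: mg].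
pose W := [set ax : R * R | x <= ax.1 + ax.2 <= y].
have mW : measurable W.
  rewrite (_ : W = (fun ax : R * R => ax.1 + ax.2) @^-1` `[x, y]).
    by rewrite -[X in measurable X]setTI; apply: measurable_funD.
  by apply/seteqP; split => w /=; rewrite in_itv.
pose E := above_grid centered 0 p c n.
have mE : measurable (E : set (step_sigma X (N.+1 + N) I)).
  rewrite /E aboveE; apply: measurable_walk_above_sigma => //.
  by move=> j jN; rewrite /I ltn_eqF.
pose D w := centered q w - centered p w.
apply: (@le_trans _ _ (P (E `&` [set w | W (Y w, D w)]))).
  have gD j w : g j w + D w = centered (dyadic q r n j) w.
    by rewrite /g /D; lra.
  apply: le_measure; rewrite ?inE.
  - apply: measurableI; first exact: measurable_step_sigma mE.
    apply: measurableD; apply: measurable_above_grid => j _;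
      by apply: measurableT_comp => //; exact: measurable_centered.
  - apply: measurableI; first exact: measurable_step_sigma mE.
    have mYD : measurable_fun setT (fun w => (Y w, D w)).
      apply: measurable_fun_pair.
        apply: measurable_bigmax => [|j _]; rewrite /g;
        apply: measurable_funD; try exact: measurable_centered;
        apply: measurable_funB; exact: measurable_centered.
      by apply: measurable_funB; exact: measurable_centered.
    by rewrite -[X in measurable X]setTI; exact: mYD.
  - apply: setIS => w [/= wy wx]; rewrite /W/=; apply/andP; split.
      rewrite leNgt; apply/negP => Yx; apply: wx => j jN.
      rewrite /opp_path lerN2 -gD ltW// (le_lt_trans _ Yx)// lerD2r.
      exact: (le_bigmax _ (fun j : 'I_N.+1 => g j w) (Ordinal (jN : (j < N.+1)%N))).
    rewrite -lerBrDr; apply: bigmax_le => [|[j jN] _ /=]; rewrite lerBrDr gD.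
      by rewrite -lerN2; exact: wy.
    by rewrite -lerN2; exact: wy.
apply: joint_law_le => //.
- exact: measurable_step_sigma mE.
- by apply: measurable_funB; exact: measurable_centered.
- move=> mT V mV.
  apply: (measurable_step_sigma mX (n := N.+1 + N) (I := I)); exact: mY.
- move=> U V mU mV; apply: (@indep_rectangles _ _ _ P X mX (N.+1 + N) indepX I).
    apply: (@measurableI _ (step_sigma X (N.+1 + N) I)) => //.
    by rewrite -[X in measurable X]setTI; exact: mY.
  have mD : measurable_fun setT (D : step_sigma X (N.+1 + N) (predC I) -> R).
    rewrite /D -tauN (_ : q = tau N.+1); last first.
      by rewrite -[N.+1]addn0 tauS dyadic0.
    apply: tau_incr => //; first by rewrite leq_addr.
    move=> i /andP[Ni iN]; rewrite /= /I negbK; apply/eqP; lia.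
  by rewrite -[X in <<s _ >> X]setTI; exact: mD.
- by rewrite mulr_ge0 ?normal_peak_ge0// subr_ge0.
- move=> z; pose m := z + mu * (q - p).
  rewrite (_ : [set w | _] = increment B p q @^-1` `[x - m, y - m]).
    rewrite (bm_gaussian hB)//.
    apply: (le_trans (normal_prob_itv_le _ _ _)).
    - by rewrite gt_eqF// sqrtr_gt0 subr_gt0.
    - by rewrite lerB.
    - by rewrite lee_fin le_eqVlt; apply/orP; left; apply/eqP; congr (_ * _); lra.
  apply/seteqP; split=> w /=; rewrite in_itv /W /D /centered /increment /m /=;
    move=> /andP[h1 h2]; apply/andP; split; lra.
Qed.

End grid_walk.

Lemma continuous_centered_from q r w : 0 <= q ->
  {within `[q, r], continuous (centered_from q ^~ w)}.
Proof.
move=> q0 x; apply: cvgB; first exact: continuous_centered.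
exact: cvg_cst.
Qed.

Lemma measurable_centered_from q z : measurable_fun setT (centered_from q z).
Proof. by apply: measurable_funB; exact: measurable_centered. Qed.

Lemma continuous_opp_centered q r w : 0 <= q ->
  {within `[q, r], continuous (opp_path centered ^~ w)}.
Proof. by move=> q0 x; apply: cvgN; exact: continuous_centered. Qed.

Lemma measurable_opp_centered z : measurable_fun setT (opp_path centered z).
Proof. by apply: measurableT_comp => //; exact: measurable_centered. Qed.

(** The events on the grids decrease to those for all times. *)
Lemma survival_product p t c k e : 0 <= p -> p <= t ->
  (P (above centered 0 p c) * P [set w | (k <= centered p w)%R] *
   P (above (centered_from p) p t e) <=
   P (above centered 0 p c `&` [set w | (k <= centered p w)%R] `&`
      above (centered_from p) p t e))%E.
Proof.
move=> p0 pt; set K := [set w | _].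
pose F n := above_grid centered 0 p c n `&` K `&`
  above_grid (centered_from p) p t e n.
have mF n : measurable (F n).
  apply: measurableI; first apply: measurableI; last 2 first.
  - by apply: measurable_ge; exact: measurable_centered.
  - by apply: measurable_above_grid => j _; exact: measurable_centered_from.
  - by apply: measurable_above_grid => j _; exact: measurable_centered.
have FE : \bigcap_n F n = above centered 0 p c `&` K `&`
    above (centered_from p) p t e.
  rewrite -(bigcap_above_grid _ p0); last by move=> w; exact: continuous_centered.
  rewrite -(bigcap_above_grid _ pt); last by move=> w; exact: continuous_centered_from.
  apply/seteqP; split=> w.
    move=> h; split; [split; [|exact: (h 0%N I).1.2]|] => n _.
      exact: (h n I).1.1.
    exact: (h n I).2.
  by move=> [[h1 h2] h3] n _; split; [split => //; exact: h1|exact: h3].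
have : P \o F @ \oo --> P (\bigcap_n F n).
  apply: nonincreasing_cvg_mu => //.
  - by rewrite -ge0_fin_numE// fin_num_measure.
  - by apply: bigcap_measurable => //; exact: (ex_intro _ 0%N).
  - move=> m n mn; apply/subsetPset; apply: setISS; first apply: setISS => //.
      by apply/subsetPset; exact: above_grid_nonincreasing.
    by apply/subsetPset; exact: above_grid_nonincreasing.
rewrite FE; apply: cvge_ge; apply: nearW => n /=.
apply: le_trans (grid_survival n p0 (lexx p) pt c k e erefl).
have leP (f : R -> T -> R) (a b x : R) :
    a <= b -> (forall z, measurable_fun setT (f z)) ->
    (forall w, {within `[a, b], continuous (f ^~ w)}) ->
    (P (above f a b x) <= P (above_grid f a b x n))%E.
  move=> ab mf cf; apply: le_measure; rewrite ?inE; last exact: above_sub_grid.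
    exact: measurable_above.
  by apply: measurable_above_grid => j _; exact: mf.
apply: lee_pmul; rewrite ?mule_ge0//; last first.
  apply: leP => // [z|w]; first exact: measurable_centered_from.
  exact: continuous_centered_from.
apply: lee_wpmul2r => //.
apply: leP => // [z|w]; [exact: measurable_centered|exact: continuous_centered].
Qed.

Lemma measurable_above_centered p c : 0 <= p -> measurable (above centered 0 p c).
Proof.
move=> p0; apply: measurable_above => // [z|w];
  [exact: measurable_centered|exact: continuous_centered].
Qed.

(** Being at height k at time p and never losing more than k afterwards implies
    staying above any c <= 0.  Both have positive probability for k large, the
    second one because a continuous path on a compact interval is bounded. *)
Lemma survival_ratio p t : 0 < p -> p <= t ->
  exists2 K : R, 0 <= K & forall c, c <= 0 ->
    (P (above centered 0 p c) <= K%:E * P (above centered 0 t c))%E.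
Proof.
move=> p0 pt; have p0' := ltW p0.
have mK k : measurable [set w | k <= centered p w].
  by apply: measurable_ge; exact: measurable_centered.
pose F k := above (centered_from p) p t (- (k%:R)).
have mF k : measurable (F k).
  apply: measurable_above => // [z|w];
    [exact: measurable_centered_from|exact: continuous_centered_from].
have FT : \bigcup_k F k = setT.
  apply/seteqP; split=> // w _.
  have [z zpt zmin] := EVT_min pt (@continuous_centered_from p t w p0').
  exists (Num.truncn `|centered_from p z w|).+1 => // x xpt /=.
  apply: le_trans (zmin _ xpt); rewrite lerNl.
  by rewrite (le_trans (ler_norm _))// normrN ltW// truncnS_gt.
have [k Fk0] : exists k, (0 < P (F k))%E.
  apply: contrapT => /forallNP h.
  have : P \o F @ \oo --> P (\bigcup_k F k).
    apply: nondecreasing_cvg_mu => //; first by rewrite FT.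
    move=> i j ij; apply/subsetPset => w h' z zpt; apply: le_trans (h' z zpt).
    by rewrite lerN2 ler_nat.
  rewrite FT probability_setT (_ : P \o F = cst 0%E).
    move=> /(cvg_lim (@ereal_hausdorff _)); rewrite lim_cst// => /eqP.
    by rewrite eq_sym onee_eq0.
  apply/funext => j /=; apply/eqP; rewrite eq_le measure_ge0 andbT leNgt.
  by apply/negP; exact: h.
have Pk0 : (0 < P [set w | (k%:R <= centered p w)%R])%E.
  pose m := k%:R - mu * p.
  apply: (@lt_le_trans _ _ (normal_prob 0 (Num.sqrt (p - 0)) `[m, m + 1])).
    by apply: normal_prob_itv_gt0; rewrite ?ltrDl// gt_eqF// sqrtr_gt0 subr0.
  rewrite -(bm_gaussian hB)//; apply: le_measure; rewrite ?inE//.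
    by rewrite -[X in measurable X]setTI; exact: measurable_funB.
  move=> w /=; rewrite in_itv/= /increment /centered /m => /andP[]; lra.
pose e := (fine (P [set w | (k%:R <= centered p w)%R]) * fine (P (F k))).
have e0 : 0 < e.
  by rewrite mulr_gt0// fine_gt0// ?Fk0 ?Pk0/= -ge0_fin_numE// fin_num_measure.
exists e^-1; first by rewrite invr_ge0 ltW.
move=> c c0; rewrite -(@lee_pmul2l _ e%:E)//.
rewrite muleA -EFinM divff ?gt_eqF// mul1e.
apply: (@le_trans _ _ (P (above centered 0 p c `&`
    [set w | (k%:R <= centered p w)%R] `&` F k))).
  rewrite /e EFinM !fineK ?fin_num_measure// [leLHS]muleC muleA.
  exact: survival_product.
apply: le_measure; rewrite ?inE.
- by apply: measurableI => //; apply: measurableI => //; exact: measurable_above_centered.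
- by apply: measurable_above_centered; exact: le_trans pt.
- move=> w [[wp wk] wF] z; rewrite in_itv/= => /andP[z0 zt].
  have [zp|pz] := leP z p; first by apply: wp; rewrite in_itv/= z0.
  have /wF : z \in `[p, t] by rewrite in_itv/= (ltW pz).
  rewrite /= /centered_from => h.
  by rewrite /= in wk; lra.
Qed.

(** The grid maxima increase to the maximum over [q, r].  Once a grid of level m
    sees a value larger than x, so do all finer grids, which gives the estimate for
    the events L m; these increase to the event of the lemma. *)
Lemma small_ball p q r c (x y : R) : 0 <= p -> p < q -> q <= r -> x <= y ->
  (P (above centered 0 p c `&`
      (above (opp_path centered) q r (- y) `\`
       above (opp_path centered) q r (- x))) <=
   (normal_peak (Num.sqrt (q - p)) * (y - x))%:E *
   P (above centered 0 p c))%E.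
Proof.
move=> p0 pq qr xy; set C := _%:E; have q0 : 0 <= q by exact: le_trans (ltW pq).
pose E n := above_grid centered 0 p c n.
pose L m := above centered 0 p c `&`
      (above (opp_path centered) q r (- y) `\`
       above_grid (opp_path centered) q r (- x) m).
have mE n : measurable (E n).
  by apply: measurable_above_grid => j _; exact: measurable_centered.
have mo z : measurable (above (opp_path centered) q r z).
  apply: measurable_above => // [?|w];
    [exact: measurable_opp_centered|exact: continuous_opp_centered].
have mog z n : measurable (above_grid (opp_path centered) q r z n).
  by apply: measurable_above_grid => j _; exact: measurable_opp_centered.
have mL m : measurable (L m).
  apply: measurableI; first exact: measurable_above_centered.
  exact: measurableD.
have LE m : (P (L m) <= C * P (above centered 0 p c))%E.
  have cE : (fun n => C * P (E n))%E @ \oo --> (C * P (above centered 0 p c))%E.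
    apply: cvgeZl => //.
    rewrite -(bigcap_above_grid _ p0); last by move=> w; exact: continuous_centered.
    apply: nonincreasing_cvg_mu => //.
    - by rewrite -ge0_fin_numE// fin_num_measure.
    - by apply: bigcap_measurable => //; exact: (ex_intro _ 0%N).
    - exact: above_grid_nonincreasing.
  apply: cvge_ge cE; near=> n.
  apply: le_trans (grid_small_ball n p0 (ltW pq) qr c pq xy).
  apply: le_measure; rewrite ?inE//.
    by apply: measurableI => //; apply: measurableD.
  move=> w [wp [wy wx]]; split; first exact: above_sub_grid.
  split; first exact: above_sub_grid.
  apply: contra_not wx; apply/subsetPset/above_grid_nonincreasing.
  by near: n; exact: nbhs_infty_ge.
have : P \o L @ \oo --> P (\bigcup_m L m).
  apply: nondecreasing_cvg_mu => //; first exact: bigcup_measurable.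
  move=> m n mn; apply/subsetPset; apply: setIS => w [wy wx]; split => //.
  by apply: contra_not wx; apply/subsetPset/above_grid_nonincreasing.
rewrite (_ : \bigcup_m L m = above centered 0 p c `&`
      (above (opp_path centered) q r (- y) `\`
       above (opp_path centered) q r (- x))); last first.
  apply/seteqP; split=> w.
    move=> [m _ [wp [wy wx]]]; split=> //; split=> //.
    by apply: contra_not wx; exact: above_sub_grid.
  move=> [wp [wy wx]]; apply: contrapT => h; apply: wx.
  rewrite -(bigcap_above_grid _ qr); last by move=> ?; exact: continuous_opp_centered.
  move=> m _; apply: contrapT => wm; apply: h; exists m => //.
by apply: cvge_le; apply: nearW.
Unshelve. all: by end_near. Qed.

Lemma window_small_ball q r t : 0 < q -> q <= r -> r <= t ->
  exists2 C : R, 0 <= C & forall c (x y : R), c <= 0 -> x <= y ->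
  (P (above centered 0 t c `&`
      (above (opp_path centered) q r (- y) `\`
       above (opp_path centered) q r (- x))) <=
   (C * (y - x))%:E * P (above centered 0 t c))%E.
Proof.
move=> q0 qr rt; have p0 : 0 < q / 2 by rewrite divr_gt0.
have pt : q / 2 <= t by lra.
have [K K0 HK] := survival_ratio p0 pt.
set S := normal_peak (Num.sqrt (q - q / 2)).
have S0 : 0 <= S by exact: normal_peak_ge0.
exists (S * K); first exact: mulr_ge0.
move=> c x y c0 xy.
have mo z : measurable (above (opp_path centered) q r z).
  apply: measurable_above => // [?|w];
    [exact: measurable_opp_centered|apply: continuous_opp_centered; exact: ltW].
have pq : q / 2 < q by lra.
apply: (@le_trans _ _ (P (above centered 0 (q / 2) c `&`
      (above (opp_path centered) q r (- y) `\`
       above (opp_path centered) q r (- x))))).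
  apply: le_measure; rewrite ?inE.
  - apply: measurableI; last exact: measurableD.
    by apply: measurable_above_centered; lra.
  - apply: measurableI; last exact: measurableD.
    by apply: measurable_above_centered; lra.
  - apply: setSI => w wt z; rewrite in_itv/= => /andP[z0 zp]; apply: wt.
    by rewrite in_itv/= z0; lra.
apply: (le_trans (small_ball c (ltW p0) pq qr xy)).
rewrite [S * K * _]mulrAC (EFinM _ K) -muleA; apply: lee_wpmul2l; last exact: HK.
by rewrite lee_fin mulr_ge0// subr_ge0.
Qed.

End brownian_walk.

(** * The conditioning event *)

Lemma sup_itv_le (R : realType) (f : R -> R) (a b c : R) : a <= b ->
  {within `[a, b], continuous f} ->
  (sup [set f z | z in `[a, b]] <= c) = `[< forall z, z \in `[a, b] -> f z <= c >].
Proof.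
move=> ab cf; have [m mab fm] := EVT_max ab cf.
have ub : ubound [set f z | z in `[a, b]] (f m).
  by move=> _ [z zab <-]; exact: fm.
apply/idP/asboolP => [h z zab|h].
  apply: le_trans h; apply: ub_le_sup; last by exists z.
  by exists (f m).
by apply: ge_sup; [exists (f m); exists m|move=> _ [z zab <-]; exact: h].
Qed.

Lemma inf_itv_gt (R : realType) (f : R -> R) (a b c : R) : a <= b ->
  {within `[a, b], continuous f} ->
  c < inf [set f z | z in `[a, b]] <->
  exists k, forall z, z \in `[a, b] -> c + k.+1%:R^-1 <= f z.
Proof.
move=> ab cf; have [m mab fm] := EVT_min ab cf.
have lb : lbound [set f z | z in `[a, b]] (f m).
  by move=> _ [z zab <-]; exact: fm.
split=> [cm|[k ck]].
  have {}cm : c < f m.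
    apply: lt_le_trans cm _; apply: ge_inf; last by exists m.
    by exists (f m).
  have mc : 0 < f m - c by rewrite subr_gt0.
  exists (Num.truncn (f m - c)^-1) => z zab; apply: le_trans (fm _ zab).
  rewrite -lerBrDl invf_ple ?posrE// ltW//; exact: truncnS_gt.
apply: (@lt_le_trans _ _ (c + k.+1%:R^-1)); first by rewrite ltrDl invr_gt0.
by apply: lb_le_inf; [exists (f m); exists m|move=> _ [z zab <-]; exact: ck].
Qed.

Lemma ae_eq_measure (R : realType) (d : measure_display) (T : measurableType d)
    (P : {measure set T -> \bar R}) (A A' : set T) :
  measurable A -> measurable A' ->
  {ae P, forall w, A w <-> A' w} -> P A = P A'.
Proof.
move=> mA mA' h.
suff H (X X' : set T) : measurable X -> measurable X' ->
    {ae P, forall w, X w -> X' w} -> (P X <= P X')%E.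
  apply/eqP; rewrite eq_le !H//; first by apply: filterS h => w [].
  by apply: filterS h => w [].
move=> mX mX' [N [mN N0 XN]].
rewrite -[leRHS]adde0 -[X in (_ + X)%E]N0.
apply: le_trans (measureU2 _ mX' mN); apply: le_measure; rewrite ?inE//.
  exact: measurableU.
move=> w Xw; have [X'w|X'w] := pselect (X' w); [by left|right].
by apply: XN => /= /(_ Xw).
Qed.

Section drifted_paths.
Context (R : realType) (d : measure_display) (T : measurableType d)
  (P : probability T R) (B : R -> {RV P >-> R})
  (hB : standard_brownian_motion B) (mu : R).
Implicit Types (a b c t u v : R).

Lemma drifted_centered u : {ae P, forall w, forall z,
  drifted B mu u z w = u + centered B mu z w}.
Proof.
apply: filterS (bm_start hB) => w B0 z.
by rewrite /drifted /centered B0 subr0 addrA.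
Qed.

Lemma continuous_drifted u a b w : 0 <= a ->
  {within `[a, b], continuous (drifted B mu u ^~ w)}.
Proof.
move=> a0 x.
rewrite (_ : drifted B mu u ^~ w = fun z => (u + B 0 w) + centered B mu z w).
  by apply: cvgD; [exact: cvg_cst|exact: (continuous_centered hB)].
by apply/funext => z; rewrite /drifted /centered; lra.
Qed.

Lemma measurable_drifted u z : measurable_fun setT (drifted B mu u z).
Proof. by apply: measurable_funD => //; exact: measurable_funD. Qed.

Definition window_le a b c u : set T :=
  [set w | sup [set drifted B mu u z w | z in `[a, b]] <= c].

Lemma window_leE a b c u : 0 <= a -> a <= b ->
  window_le a b c u = above (opp_path (drifted B mu u)) a b (- c).
Proof.
move=> a0 ab; apply/seteqP; split=> w;
  rewrite /window_le /above /opp_path /= sup_itv_le//; try exact: continuous_drifted.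
  by move=> /asboolP h z zab; rewrite lerN2; exact: h.
by move=> h; apply/asboolP => z zab; rewrite -lerN2; exact: h.
Qed.

Lemma measurable_above_opp_drifted a b c u : 0 <= a -> a <= b ->
  measurable (above (opp_path (drifted B mu u)) a b c).
Proof.
move=> a0 ab; apply: measurable_above => // [z|w].
  by apply: measurableT_comp => //; exact: measurable_drifted.
by move=> x; apply: cvgN; exact: continuous_drifted.
Qed.

Lemma measurable_window_le a b c u : 0 <= a -> a <= b ->
  measurable (window_le a b c u).
Proof. by move=> a0 ab; rewrite window_leE//; exact: measurable_above_opp_drifted. Qed.

Lemma stays_aboveE v t u : 0 <= t -> stays_above B mu v t u =
  \bigcup_k above (drifted B mu u) 0 t (v + k.+1%:R^-1).
Proof.
move=> t0; apply/seteqP; split=> w.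
  by move=> /(inf_itv_gt _ t0 (@continuous_drifted u 0 t w (lexx 0))) [k hk]; exists k.
move=> [k _ hk]; apply/(inf_itv_gt _ t0 (@continuous_drifted u 0 t w (lexx 0))).
by exists k.
Qed.

Lemma measurable_above_drifted t c u : 0 <= t ->
  measurable (above (drifted B mu u) 0 t c).
Proof.
move=> t0; apply: measurable_above => // [z|w];
  [exact: measurable_drifted|exact: continuous_drifted].
Qed.

Lemma measurable_stays_above v t u : 0 <= t -> measurable (stays_above B mu v t u).
Proof.
move=> t0; rewrite stays_aboveE//; apply: bigcup_measurable => k _.
exact: measurable_above_drifted.
Qed.

(** The event of staying strictly above v is the increasing union of the events of
    staying above v + 1 / (k + 1).  In centered coordinates these have the level
    v + 1 / (k + 1) - u, which is nonpositive for k large because u > v, so that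
    [window_small_ball] applies with a constant independent of k and u. *)
Lemma stays_above_small_ball a b t v : 0 < a -> a <= b -> b <= t ->
  exists2 C : R, 0 <= C & forall u (x y : R), v < u -> x <= y ->
  (P (stays_above B mu v t u `&` (window_le a b y u `\` window_le a b x u)) <=
   (C * (y - x))%:E * P (stays_above B mu v t u))%E.
Proof.
move=> a0 ab bt; have t0 : 0 < t by lra.
have a0' := ltW a0; have t0' := ltW t0.
have [C C0 HC] := window_small_ball hB mu a0 ab bt.
exists C => // u x y vu xy.
pose V := window_le a b y u `\` window_le a b x u.
have mV : measurable V by apply: measurableD; exact: measurable_window_le.
pose G k := above (drifted B mu u) 0 t (v + k.+1%:R^-1).
have mG k : measurable (G k) by exact: measurable_above_drifted.
have nG : nondecreasing_seq G.
  move=> i j ij; apply/subsetPset => w h z zt; apply: le_trans (h z zt).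
  by rewrite lerD2l lef_pV2 ?posrE// ler_nat.
have : P \o (fun k => G k `&` V) @ \oo --> P (\bigcup_k (G k `&` V)).
  apply: nondecreasing_cvg_mu => //.
  - by move=> k; exact: measurableI.
  - by apply: bigcup_measurable => k _; exact: measurableI.
  - by move=> i j ij; apply/subsetPset; apply: setSI; apply/subsetPset; exact: nG.
rewrite -setI_bigcupl -stays_aboveE//; apply: cvge_le; near=> k.
have GA : (P (G k) <= P (stays_above B mu v t u))%E.
  apply: le_measure; rewrite ?inE//; first exact: measurable_stays_above.
  by rewrite stays_aboveE// => w Gw; exists k.
apply: (@le_trans _ _ ((C * (y - x))%:E * P (G k))%E); last first.
  by apply: lee_wpmul2l => //; rewrite lee_fin mulr_ge0// subr_ge0.
pose c := v + k.+1%:R^-1 - u.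
have mo z : measurable (above (opp_path (centered B mu)) a b z).
  apply: measurable_above => // [?|w];
    [exact: measurable_opp_centered|exact: (continuous_opp_centered hB)].
have mc : measurable (above (centered B mu) 0 t c).
  exact: measurable_above_centered.
have -> : P (G k) = P (above (centered B mu) 0 t c).
  apply: ae_eq_measure => //; apply: filterS (drifted_centered u) => w hw.
  by split=> h z zt; move: (h z zt); rewrite hw /c lerBlDl.
rewrite /= (_ : P (G k `&` V) = P (above (centered B mu) 0 t c `&`
      (above (opp_path (centered B mu)) a b (- (y - u)) `\`
       above (opp_path (centered B mu)) a b (- (x - u))))).
  have -> : y - x = (y - u) - (x - u) by lra.
  apply: HC; last by rewrite lerD2r.
  rewrite /c subr_le0 -lerBrDl.
  rewrite invf_ple ?posrE ?subr_gt0//.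
  apply: (@le_trans _ _ k%:R); last by rewrite ler_nat.
  by near: k; exact: nbhs_infty_ger.
apply: ae_eq_measure.
- exact: measurableI.
- by apply: measurableI => //; exact: measurableD.
- apply: filterS (drifted_centered u) => w hw.
  have E1 : G k w <-> above (centered B mu) 0 t c w.
    by split=> h z zt; move: (h z zt); rewrite hw /c lerBlDl.
  have E2 r : window_le a b r u w <-> above (opp_path (centered B mu)) a b (- (r - u)) w.
    by rewrite window_leE//; split=> h z zt; move: (h z zt); rewrite /opp_path hw; lra.
  by rewrite /V /setI /setD/= E1 !E2.
Unshelve. all: by end_near. Qed.

End drifted_paths.

(** * The maximum over a window as a functional on path space *)

Section window_max.
Context (R : realType) (t : R).
Implicit Types (a b c z : R) (x y : path_space t).

Definition path_at x z : R := valL (x : time_interval t -> R) z.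

Lemma path_atE x z (zt : z \in time_interval t) : path_at x z = x (SigSub zt).
Proof.
by rewrite /path_at /valL_/= oinv_set_val insubT.
Qed.

Lemma continuous_path_at x : {within `[0, t], continuous (path_at x)}.
Proof. by apply/subspace_valL_continuousP; exact: cts_fun. Qed.

Lemma path_at_drifted (d : measure_display) (T : measurableType d)
  (P : probability T R) (B : R -> {RV P >-> R})
  (hB : standard_brownian_motion B) (mu u : R) w z : z \in `[0, t] ->
  path_at (drifted_path hB mu u t w) z = drifted B mu u z w.
Proof.
move=> zt; have zt' : z \in time_interval t by rewrite inE.
by rewrite (path_atE _ zt').
Qed.

Lemma path_ball x y e : ball x e y -> forall z, z \in `[0, t] ->
  `|path_at x z - path_at y z| < e.
Proof.
move=> xy z zt; have zt' : z \in time_interval t by rewrite inE.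
by rewrite !(path_atE _ zt'); exact: xy.
Qed.

Definition window_max a b x : R := sup [set path_at x z | z in `[a, b]].

Section window.
Context (a b : R).
Hypotheses (a0 : 0 <= a) (ab : a <= b) (bt : b <= t).

Let cx x : {within `[a, b], continuous (path_at x)}.
Proof.
apply: (continuous_subspaceW _ (@continuous_path_at x)) => z /=.
by rewrite !in_itv/= => /andP[az zb]; rewrite (le_trans a0 az) (le_trans zb bt).
Qed.

Lemma window_max_leP x c :
  (window_max a b x <= c) <-> forall z, z \in `[a, b] -> path_at x z <= c.
Proof. by rewrite /window_max sup_itv_le//; split=> /asboolP. Qed.

Lemma path_at_le_max x z : z \in `[a, b] -> path_at x z <= window_max a b x.
Proof. by move: z; apply/window_max_leP. Qed.

(** The maximum is 1-Lipschitz for the uniform distance. *)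
Lemma continuous_window_max : continuous (window_max a b).
Proof.
have H x y e : ball x e y -> window_max a b y <= window_max a b x + e.
  move=> xy; apply/window_max_leP => z zab.
  have zt : z \in `[0, t].
    move: zab; rewrite !in_itv/= => /andP[az zb].
    by rewrite (le_trans a0 az) (le_trans zb bt).
  have := path_ball xy zt; have := path_at_le_max x zab.
  rewrite ltr_norml => h /andP[]; lra.
move=> x; have Fx : Filter (nbhs x) := nbhs_filter x.
apply/cvgrPdist_le => e e0.
have : \forall y \near x, ball x e y by exact: nbhsx_ballx.
apply: (@filterS _ _ (nbhs_filter (x : path_space t))) => y xy.
have yx : ball y e x by exact: ball_sym.
have := H _ _ _ xy; have := H _ _ _ yx; rewrite ler_norml => h1 h2.
by apply/andP; split; lra.
Qed.

Lemma measurable_window_max_le c :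
  measurable ([set x | window_max a b x <= c] : set (borel_path_space t)).
Proof.
rewrite (_ : [set x | _] = ~` (window_max a b @^-1` `]c, +oo[)).
  apply: measurableC; apply: sub_sigma_algebra.
  apply: (open_comp _ (@interval_open _ _ _ _ _)) => // x _.
  exact: continuous_window_max.
by apply/seteqP; split=> x /=; rewrite in_itv/= andbT leNgt => /negP.
Qed.

End window.

Lemma window_max_singleton a x : window_max a a x = path_at x a.
Proof.
rewrite /window_max set_itv1 image_set1 sup1//.
Qed.

End window_max.

(** * Convergence of the law of the maximum over a window *)

Section ramp.
Context (R : realType).
Implicit Types c e r : R.

(** The piecewise linear function equal to 1 up to c and to 0 from c + e on: a
    continuous substitute for the indicator function of a half-line. *)
Definition ramp c e r : R := Num.min 1 (Num.max 0 ((c + e - r) / e)).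

Lemma ramp_ge0 c e r : 0 <= ramp c e r.
Proof. by rewrite /ramp le_min ler01 le_max lexx. Qed.

Lemma ramp_le1 c e r : ramp c e r <= 1.
Proof. by rewrite /ramp ge_min lexx. Qed.

Lemma ramp1 c e r : 0 < e -> r <= c -> ramp c e r = 1.
Proof.
move=> e0 rc; apply/eqP; rewrite eq_le ramp_le1 /ramp le_min lexx le_max/=.
by rewrite ler_pdivlMr// mul1r; apply/orP; right; lra.
Qed.

Lemma ramp0 c e r : 0 < e -> c + e <= r -> ramp c e r = 0.
Proof.
move=> e0 rc; apply/eqP; rewrite eq_le ramp_ge0 andbT /ramp ge_min ge_max lexx/=.
by rewrite ler_pdivrMr// mul0r; apply/orP; right; lra.
Qed.

Lemma continuous_ramp c e : continuous (ramp c e).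
Proof.
rewrite (_ : ramp c e = cst 1 \min (cst 0 \max (fun r => (c + e - r) / e)))//.
move=> r; apply: continuous_min; first exact: cvg_cst.
apply: continuous_max; first exact: cvg_cst.
apply: cvgM; last exact: cvg_cst.
by apply: cvgB; [exact: cvg_cst|exact: cvg_id].
Qed.

End ramp.

Lemma Rintegral_sandwich (R : realType) (d : measure_display)
    (T : measurableType d) (m : probability T R) (A D1 D2 : set T) (g : T -> R) :
  measurable A -> measurable D1 -> measurable D2 -> measurable_fun setT g ->
  (forall w, 0 <= g w <= 1) -> (forall w, D1 w -> g w = 1) ->
  (forall w, ~ D2 w -> g w = 0) ->
  fine (m (D1 `&` A)) <= \int[m]_(w in A) g w <= fine (m (D2 `&` A)).
Proof.
move=> mA mD1 mD2 mg g01 gD1 gD2.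
have g0 w : 0 <= g w by case/andP: (g01 w).
have mgE : measurable_fun A (EFin \o g).
  by apply/measurable_EFinP; exact: measurable_funTS.
have mI D : measurable D -> measurable_fun A (fun w => (\1_D w)%:E : \bar R).
  by move=> mD; apply/measurable_EFinP; apply: measurable_funTS; exact: measurable_indic.
have le1 : (m (D1 `&` A) <= \int[m]_(w in A) (g w)%:E)%E.
  rewrite -integral_indic//; apply: ge0_le_integral => //.
  - by apply: mI.
  - move=> w _; rewrite lee_fin indicE; case: (boolP (w \in D1)) => //.
    by rewrite inE => /gD1 ->.
have le2 : (\int[m]_(w in A) (g w)%:E <= m (D2 `&` A))%E.
  rewrite -integral_indic//; apply: ge0_le_integral => //.
  - by move=> w _; rewrite lee_fin.
  - by apply: mI.
  - move=> w _; rewrite lee_fin indicE; case: (boolP (w \in D2)) => /=.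
      by case/andP: (g01 w).
    by move/negP; rewrite inE => /gD2 ->.
have fD2 : m (D2 `&` A) \is a fin_num by rewrite fin_num_measure//; exact: measurableI.
have fg : (\int[m]_(w in A) (g w)%:E)%E \is a fin_num.
  rewrite ge0_fin_numE; last by apply: integral_ge0 => w _; rewrite lee_fin.
  by apply: le_lt_trans le2 _; rewrite -ge0_fin_numE.
by rewrite /Rintegral !fine_le// fin_num_measure//; exact: measurableI.
Qed.

Lemma measurable_fun_le (R : realType) (d : measure_display)
    (T : measurableType d) (f : T -> R) :
  (forall c, measurable [set w | f w <= c]) -> measurable_fun setT f.
Proof.
move=> mf; apply: (measurability _ (@RGenOInfty.measurableE R)) => //= _ [_ [c ->] <-].
rewrite setTI (_ : _ @^-1` _ = ~` [set w | f w <= c]); last first.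
  by apply/seteqP; split => w /=; rewrite in_itv/= andbT ltNge => /negP.
exact: measurableC.
Qed.

Section weak_limit.
Context (R : realType) (d : measure_display) (T : measurableType d)
  (P : probability T R) (B : R -> {RV P >-> R})
  (hB : standard_brownian_motion B) (mu v t : R)
  (Q : probability (borel_path_space t) R) (hQ : conditioned_law hB mu v Q).
Context (a b : R) (a0 : 0 < a) (ab : a <= b) (bt : b <= t).

Let a0' : 0 <= a. Proof. exact: ltW. Qed.
Let t0 : 0 <= t. Proof. exact: le_trans (le_trans a0' ab) bt. Qed.

Let A u := stays_above B mu v t u.
Let p c u := cond_prob P (window_le B mu a b c u) (A u).
Let q c := fine (Q [set x : path_space t | window_max a b x <= c]).

Let mA u : measurable (A u). Proof. exact: measurable_stays_above. Qed.
Let mW c u : measurable (window_le B mu a b c u).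
Proof. exact: measurable_window_le. Qed.

Let F c e : path_space t -> R := ramp c e \o window_max a b.

Let cF c e : continuous (F c e).
Proof.
move=> x; apply: continuous_comp; last exact: continuous_ramp.
exact: continuous_window_max.
Qed.

Let bF c e : bounded_fun (F c e).
Proof.
exists 1; split => // M M1 x _ /=; rewrite ger0_norm ?ramp_ge0//.
exact: le_trans (ramp_le1 _ _ _) (ltW M1).
Qed.

Let window_max_drifted u w : window_max a b (drifted_path hB mu u t w) =
  sup [set drifted B mu u z w | z in `[a, b]].
Proof.
rewrite /window_max; congr sup; apply/seteqP; split=> _ [z zab <-];
  exists z => //; rewrite path_at_drifted//; move: zab; rewrite /= !in_itv/=;
  by move=> /andP[az zb]; rewrite (le_trans a0' az) (le_trans zb bt).
Qed.

Let mmax u : measurable_fun setT (fun w => window_max a b (drifted_path hB mu u t w)).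
Proof.
by apply: measurable_fun_le => c; under eq_set do rewrite window_max_drifted; exact: mW.
Qed.

Let expectation_bounds c e u : 0 < e ->
  p c u <= cond_expectation P (F c e \o drifted_path hB mu u t) (A u) <= p (c + e) u.
Proof.
move=> e0; rewrite /p /cond_prob /cond_expectation.
have /andP[h1 h2] : fine (P (window_le B mu a b c u `&` A u)) <=
   \int[P]_(w in A u) (F c e \o drifted_path hB mu u t) w <=
   fine (P (window_le B mu a b (c + e) u `&` A u)).
  apply: Rintegral_sandwich => //.
  - apply: measurableT_comp (mmax u); apply: continuous_measurable_fun.
    exact: continuous_ramp.
  - by move=> w; rewrite /= ramp_ge0 ramp_le1.
  - by move=> w; rewrite /window_le /= => h; rewrite /F/= window_max_drifted ramp1.
  - move=> w; rewrite /window_le /= => /negP; rewrite -ltNge => h.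
    by rewrite /F/= window_max_drifted ramp0// ltW.
by rewrite !ler_wpM2r// invr_ge0 fine_ge0.
Qed.

Let limit_bounds c e : 0 < e -> q c <= \int[Q]_x F c e x <= q (c + e).
Proof.
move=> e0; rewrite /q -[[set x | window_max a b x <= c]]setIT.
rewrite -[[set x | window_max a b x <= c + e]]setIT.
apply: Rintegral_sandwich => //.
- exact: (measurable_window_max_le a0' ab bt).
- exact: (measurable_window_max_le a0' ab bt).
- apply: measurableT_comp; last first.
    by apply: measurable_fun_le => r; exact: (measurable_window_max_le a0' ab bt).
  by apply: continuous_measurable_fun; exact: continuous_ramp.
- by move=> w; rewrite /= ramp_ge0 ramp_le1.
- by move=> x /= h; rewrite /F/= ramp1.
- by move=> x /= /negP; rewrite -ltNge => h; rewrite /F/= ramp0// ltW.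
Qed.

Let upper c e : 0 < e -> \forall u \near v^'+, p c u <= q (c + e) + e.
Proof.
move=> e0; have /andP[_ h] := limit_bounds c e0.
have {h}h : \int[Q]_x F c e x < q (c + e) + e by lra.
apply: filterS (cvgr_le _ (hQ (@cF c e) (bF c e)) _ h) => u.
by apply: le_trans; case/andP: (expectation_bounds c u e0).
Qed.

Let lower c e : 0 < e -> \forall u \near v^'+, q c <= p (c + e) u + e.
Proof.
move=> e0; have /andP[h _] := limit_bounds c e0.
have {h}h : q c - e < \int[Q]_x F c e x by lra.
apply: filterS (cvgr_ge _ (hQ (@cF c e) (bF c e)) _ h) => u.
have /andP[_ h'] := expectation_bounds c u e0.
by rewrite -lerBlDr => /le_trans; apply.
Qed.

Let small_ball_cond : exists2 C : R, 0 <= C & forall u x y, v < u -> x <= y ->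
  p y u - p x u <= C * (y - x).
Proof.
have [C C0 HC] := stays_above_small_ball hB mu v a0 ab bt.
exists C => // u x y vu xy.
rewrite /p /cond_prob -mulrBl.
(* a quotient by 0 is 0, so that both probabilities vanish in this case *)
have [PA0|PA0] := eqVneq (fine (P (A u))) 0.
  by rewrite PA0 invr0 mulr0 mulr_ge0// subr_ge0.
have {}PA0 : 0 < fine (P (A u)) by rewrite lt_neqAle eq_sym PA0 fine_ge0.
rewrite ler_pdivrMr//.
have fin (D : set T) : measurable D -> P D \is a fin_num by exact: fin_num_measure.
have mI c : measurable (window_le B mu a b c u `&` A u) by exact: measurableI.
have mV : measurable (A u `&` (window_le B mu a b y u `\` window_le B mu a b x u)).
  by apply: measurableI => //; exact: measurableD.
rewrite lerBlDl -lee_fin EFinD EFinM !fineK ?fin//.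
rewrite (le_trans _ (leeD2l _ (HC u x y vu xy)))//.
apply: le_trans (measureU2 _ (mI x) mV); apply: le_measure; rewrite ?inE//.
  exact: measurableU.
move=> w [wy wA]; have [wx|wx] := pselect (window_le B mu a b x u w); first by left.
by right.
Qed.

(** A ramp lies between the indicator functions of two half-lines, so weak
    convergence compares the two distribution functions up to a shift of their
    argument; the small ball estimate bounds the effect of that shift uniformly in
    u. *)
Lemma window_prob_cvg c :
  cond_prob P (window_le B mu a b c u) (stays_above B mu v t u) @[u --> v^'+]
  --> fine (Q [set x : path_space t | window_max a b x <= c]).
Proof.
rewrite -/(q c); have [C C0 HC] := small_ball_cond.
apply/cvgrPdist_le => e e0.
pose e' := e / (C + 1).
have C1 : 0 < C + 1 by lra.
have e'0 : 0 < e' by rewrite divr_gt0.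
have eE : C * e' + e' = e by rewrite /e'; field; rewrite gt_eqF.
near=> u.
have vu : v < u by near: u; exact: nbhs_right_gt.
have h1 : q c <= p (c + e') u + e' by near: u; exact: lower.
have h2 : p (c - e') u <= q (c - e' + e') + e' by near: u; exact: upper.
rewrite subrK in h2.
have h3 : p (c + e') u - p c u <= C * e'.
  have := HC u c (c + e') vu; rewrite [c + e' - c]addrC addKr; apply.
  by rewrite lerDl ltW.
have h4 : p c u - p (c - e') u <= C * e'.
  have := HC u (c - e') c vu; rewrite subKr; apply.
  by rewrite gerBl ltW.
rewrite -/(p c u) ler_norml; apply/andP; split; lra.
Unshelve. all: by end_near. Qed.

(** The small ball estimate passes to the limit. *)
Lemma window_limit_lipschitz : exists2 C : R, 0 <= C & forall x y, x <= y ->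
  fine (Q [set w : path_space t | window_max a b w <= y]) -
  fine (Q [set w : path_space t | window_max a b w <= x]) <= C * (y - x).
Proof.
have [C C0 HC] := small_ball_cond; exists C => // x y xy.
have pq : (fun u => p y u - p x u) @ v^'+ --> q y - q x.
  by apply: cvgB; exact: window_prob_cvg.
apply: (cvgr_to_le pq); near=> u; apply: HC => //; near: u; exact: nbhs_right_gt.
Unshelve. all: by end_near. Qed.

End weak_limit.

(** * Shrinking the window *)

(** A path that stays above v is positive, hence equal to its absolute value. *)
Lemma window_bounded_stays_above (R : realType) (d : measure_display)
    (T : measurableType d) (P : probability T R) (B : R -> {RV P >-> R})
    (hB : standard_brownian_motion B) (mu v s t delta eta u : R) :
  0 < v -> 0 <= s - delta -> s + delta <= t -> s - delta <= s + delta ->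
  window_bounded B mu s delta eta u `&` stays_above B mu v t u =
  window_le B mu (s - delta) (s + delta) eta u `&` stays_above B mu v t u.
Proof.
move=> v0 sd0 sdt sdd; rewrite setIC [RHS]setIC.
suff E w : stays_above B mu v t u w ->
    [set `|drifted B mu u z w| | z in `[s - delta, s + delta]] =
    [set drifted B mu u z w | z in `[s - delta, s + delta]].
  apply/seteqP; split=> w [wA].
    by rewrite /window_bounded /= E.
  by split=> //; rewrite /window_bounded /= E.
rewrite stays_aboveE//; last lra.
move=> [k _ wA].
have pos z : z \in `[s - delta, s + delta] -> 0 < drifted B mu u z w.
  rewrite in_itv/= => /andP[h1 h2].
  have := wA z; rewrite in_itv/= (le_trans sd0 h1) (le_trans h2 sdt) => /(_ isT).
  by apply: lt_le_trans; rewrite addr_gt0// invr_gt0.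
by apply/seteqP; split=> _ [z zd <-]; exists z => //; rewrite gtr0_norm//; exact: pos.
Qed.

(** The maximum is at least the value at s, which gives one inequality.
    Conversely a path whose value at s is less than eta stays below eta on a
    sufficiently small window, so that the limit is at least the probability that
    the value at s is at most eta - e', for every e' > 0; the Lipschitz hypothesis
    lets e' tend to 0. *)
Lemma window_shrink_cvg (R : realType) (s t eta : R)
    (Q : probability (borel_path_space t) R) :
  0 < s -> s < t ->
  (exists2 C : R, 0 <= C & forall x y, x <= y ->
    fine (Q [set w : path_space t | path_at w s <= y]) -
    fine (Q [set w : path_space t | path_at w s <= x]) <= C * (y - x)) ->
  fine (Q [set w : path_space t | window_max (s - delta) (s + delta) w <= eta])
    @[delta --> 0^'+] --> fine (Q [set w : path_space t | path_at w s <= eta]).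
Proof.
move=> s0 st [C C0 HC].
pose d0 := Num.min s (t - s) / 2.
have d00 : 0 < d0 by rewrite divr_gt0// lt_min s0 subr_gt0.
have d0s : d0 < s.
  have : Num.min s (t - s) <= s by rewrite ge_min lexx.
  by rewrite /d0; lra.
have d0t : s + d0 < t.
  have : Num.min s (t - s) <= t - s by rewrite ge_min lexx orbT.
  by rewrite /d0; lra.
pose W delta c := [set w : path_space t | window_max (s - delta) (s + delta) w <= c].
pose V c := [set w : path_space t | path_at w s <= c].
have mW delta c : 0 <= delta -> delta <= d0 ->
    measurable (W delta c : set (borel_path_space t)).
  by move=> ? ?; apply: measurable_window_max_le; lra.
have mV c : measurable (V c : set (borel_path_space t)).
  rewrite (_ : V c = W 0 c); first by apply: mW; lra.
  by apply/seteqP; split=> w; rewrite /W /V /= subr0 addr0 window_max_singleton.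
have WV delta c : 0 <= delta -> delta <= d0 -> W delta c `<=` V c.
  move=> ? ? w /=; apply: le_trans; apply: path_at_le_max; [lra..|].
  by rewrite in_itv/=; apply/andP; split; lra.
have Wmono delta delta' c : 0 <= delta' -> delta' <= delta -> delta <= d0 ->
    W delta c `<=` W delta' c.
  move=> ? ? ? w /= h; apply/window_max_leP; [lra..|] => z zd.
  apply: le_trans h; apply: path_at_le_max; [lra..|].
  by move: zd; rewrite !in_itv/= => /andP[h1 h2]; apply/andP; split; lra.
pose dn n : R := d0 / n.+1%:R.
have dn0 n : 0 < dn n by rewrite divr_gt0.
have dnd n : dn n <= d0 by rewrite ler_pdivrMr// ler_peMr ?ler1n// ltW.
have fin (D : set (path_space t)) : measurable (D : set (borel_path_space t)) ->
    Q D \is a fin_num by move=> mD; exact: fin_num_measure.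
have lef (D D' : set (path_space t)) : measurable (D : set (borel_path_space t)) ->
    measurable (D' : set (borel_path_space t)) -> D `<=` D' -> fine (Q D) <= fine (Q D').
  move=> mD mD' DD'; rewrite fine_le ?fin//.
  by apply: le_measure; rewrite ?inE.
apply/cvgrPdist_le => e e0.
pose e' := e / (C + 1).
have C1 : 0 < C + 1 by lra.
have e'0 : 0 < e' by rewrite divr_gt0.
have eE : C * e' + e' = e by rewrite /e'; field; rewrite gt_eqF.
have [n hn] : exists n, fine (Q (V (eta - e'))) - e' <= fine (Q (W (dn n) eta)).
  have mU : measurable ((\bigcup_n W (dn n) eta) : set (borel_path_space t)).
    by apply: bigcup_measurable => n _; apply: mW => //; exact: ltW.
  have cv : Q \o (fun n => W (dn n) eta) @ \oo --> Q (\bigcup_n W (dn n) eta).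
    apply: nondecreasing_cvg_mu => //.
    - by move=> n; apply: mW => //; exact: ltW.
    - move=> i j ij; apply/subsetPset; apply: Wmono => //; first exact: ltW.
      by rewrite ler_pM2l// lef_pV2 ?posrE// ler_nat.
  have sub : V (eta - e') `<=` \bigcup_n W (dn n) eta.
    move=> w /= ws.
    have cw : {within `[s - d0, s + d0], continuous (path_at w)}.
      apply: (continuous_subspaceW _ (@continuous_path_at _ _ w)) => z /=.
      by rewrite !in_itv/= => /andP[h1 h2]; apply/andP; split; lra.
    have sd : s \in `[s - d0, s + d0] by rewrite in_itv/=; apply/andP; split; lra.
    have := (subspace_continuousP _ _).1 cw s sd.
    move=> /cvgrPdist_lt/(_ _ e'0)/nbhs_ballP[r /= r0 hr].
    pose n := Num.truncn (d0 / r).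
    have dnr : dn n < r.
      by rewrite /dn ltr_pdivrMr// mulrC -ltr_pdivrMr//; exact: truncnS_gt.
    exists n => //; have := dnd n; have := dn0 n => dn0' dnd'.
    apply/window_max_leP; [lra..|] => z; rewrite in_itv/= => /andP[h1 h2].
    have zr : `|s - z| < r by rewrite ltr_norml; apply/andP; split; lra.
    have zd : z \in `[s - d0, s + d0] by rewrite in_itv/=; apply/andP; split; lra.
    have : `|path_at w s - path_at w z| < e' := hr z zr zd.
    have ws1 : path_at w s <= eta - e' := ws.
    rewrite ltr_norml => /andP[zs _]; move: zs ws1; clear; lra.
  have fcv : (fun n => fine (Q (W (dn n) eta))) @ \oo -->
      fine (Q (\bigcup_n W (dn n) eta)).
    by apply: fine_cvg; rewrite fineK ?fin.
  have le1 : fine (Q (V (eta - e'))) <= fine (Q (\bigcup_n W (dn n) eta)) by exact: lef.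
  have lt1 : fine (Q (V (eta - e'))) - e' < fine (Q (\bigcup_n W (dn n) eta)) by lra.
  by have [n _ /(_ n (leqnn n))] := cvgr_ge _ fcv _ lt1; exists n.
near=> delta.
have del0 : 0 < delta by near: delta; exact: nbhs_right_gt.
have deln : delta <= dn n by near: delta; exact: nbhs_right_le.
have deld := le_trans deln (dnd n).
have h1 : fine (Q (W delta eta)) <= fine (Q (V eta)).
  by apply: lef => //; [apply: mW => //; exact: ltW|apply: WV => //; exact: ltW].
have h2 : fine (Q (W (dn n) eta)) <= fine (Q (W delta eta)).
  by apply: lef; [apply: mW => //; exact: ltW|apply: mW => //; exact: ltW|
    apply: Wmono => //; exact: ltW].
have h3 : fine (Q (V eta)) - fine (Q (V (eta - e'))) <= C * e'.
  have := HC (eta - e') eta; rewrite subKr; apply.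
  by rewrite gerBl ltW.
by rewrite -/(V eta) -/(W delta eta) ler_norml; apply/andP; split; lra.
Unshelve. all: by end_near. Qed.

Theorem corollary3p3 (R : realType) (d : measure_display)
    (T : measurableType d) (P : probability T R)
    (B : R -> {RV P >-> R}) (hB : standard_brownian_motion B)
    (mu v s t eta : R) (hv : 0 < v) (hs : 0 < s) (hst : s < t)
    (heta : 0 < eta)
    (Q : probability (borel_path_space t) R)
    (hQ : conditioned_law hB mu v Q) :
  (forall delta : R, 0 < delta -> 0 < s - delta -> s + delta < t ->
     cvg (cond_prob P (window_bounded B mu s delta eta u)
                      (stays_above B mu v t u) @[u --> v^'+])) /\
  lim (cond_prob P (window_bounded B mu s delta eta u)
                   (stays_above B mu v t u) @[u --> v^'+])
    @[delta --> 0^'+] -->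
  fine (Q [set x : path_space t | valL (x : time_interval t -> R) s <= eta]).
Proof.
have window_cvg delta : 0 < delta -> 0 < s - delta -> s + delta < t ->
    cond_prob P (window_bounded B mu s delta eta u)
                (stays_above B mu v t u) @[u --> v^'+] -->
    fine (Q [set w : path_space t |
      window_max (s - delta) (s + delta) w <= eta]).
  move=> d0 sd0 sdt; have sdd : s - delta <= s + delta by lra.
  rewrite (_ : (fun u => _) = fun u => cond_prob P
      (window_le B mu (s - delta) (s + delta) eta u) (stays_above B mu v t u)).
    exact: (window_prob_cvg hQ sd0 sdd (ltW sdt)).
  apply/funext => u; rewrite /cond_prob (window_bounded_stays_above hB)//.
    exact: ltW.
  exact: ltW.
split=> [delta d0 sd0 sdt|].
  by apply: cvgP; exact: window_cvg.
have limE : {near 0^'+, (fun delta : R => fine (Q [set w : path_space t |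
      window_max (s - delta) (s + delta) w <= eta])) =1
    fun delta => lim (cond_prob P (window_bounded B mu s delta eta u)
                   (stays_above B mu v t u) @[u --> v^'+])}.
  near=> delta; apply/esym/cvg_lim => //; apply: window_cvg.
  - by near: delta; exact: nbhs_right_gt.
  - rewrite subr_gt0; near: delta; exact: nbhs_right_lt.
  - rewrite -ltrBrDl; near: delta; apply: nbhs_right_lt; lra.
apply: (cvg_trans (near_eq_cvg limE)).
apply: window_shrink_cvg => //.
have [C C0 HC] := window_limit_lipschitz hQ hs (lexx s) (ltW hst).
by exists C => // x y xy; have := HC x y xy; under eq_set do rewrite window_max_singleton;
  under [X in _ - fine (Q X)]eq_set do rewrite window_max_singleton.
Unshelve. all: by end_near. Qed.
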